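(* Let $n\ge 1$ be an integer. In each of the following cases ($m$ denotes a positive integer) the value of $\lambda(D_{2n})$ is as indicated: $$\lambda(D_{2n})=\begin{cases} 3, & \text{if } 3\nmid n,\\ 4, & \text{if } n=3m,\ 2\nmid m,\\ 5, & \text{if } n=2\cdot 3\,m,\ 5\nmid m,\\ 7, & \text{if } n=2\cdot 3\cdot 5\,m,\ 7\nmid m,\\ 11, & \text{if } n=2\cdot 3\cdot 5\cdot 7\,m,\ 11\nmid m,\\ 13, & \text{if } n=2\cdot 3\cdot 5\cdot 7\cdot 11\,m,\ 13\nmid m,\\ 16, & \text{if } n=2\cdot 3\cdot 5\cdot 7\cdot 11\cdot 13\,m,\ 2\nmid m,\\ 17, & \text{if } n=2^2\cdot 3\cdot 5\cdot 7\cdot 11\cdot 13\,m,\ 17\nmid m,\\ 19, & \text{if } n=2^2\cdot 3\cdot 5\cdot 7\cdot 11\cdot 13\cdot 17\,m,\ 19\nmid m,\\ 23, & \text{if } n=2^2\cdot 3\cdot 5\cdot 7\cdot 11\cdot 13\cdot 17\cdot 19\,m,\ 23\nmid m,\\ 27, & \text{if } n=2^2\cdot 3\cdot 5\cdot 7\cdot 11\cdot 13\cdot 17\cdot 19\cdot 23\,m,\ 3\nmid m,\\ 29, & \text{if } n=2^2\cdot 3^2\cdot 5\cdot 7\cdot 11\cdot 13\cdot 17\cdot 19\cdot 23\,m,\ 29\nmid m, \end{cases}$$ and for every prime $p$ with $31\le p\le 113$, $$\lambda(D_{2n})=p\quad\text{if } n=2^2\cdot 3^2\cdot\Big(\prod_{\substack{q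 \text{ prime}\\ 5\le q<p}} q\Big)\cdot m,\quad p\nmid m.$$
   Context: For a finite group $G=\{g_1,\ldots,g_N\}$ and variables $x_g$ ($g\in G$), the group determinant is the $N\times N$ determinant $\mathscr{D}_G(x_{g_1},\ldots,x_{g_N})=\det\left(x_{g_ig_j^{-1}}\right)_{1\le i,j\le N}$. Define $$\lambda(G)=\min\{|\mathscr{D}_G(x_{g_1},\ldots,x_{g_N})|\ge 2 : (x_{g_1},\ldots,x_{g_N})\in\mathbb{Z}^N\},$$ i.e. the smallest absolute value that is at least $2$ among the group determinants with integer entries. $D_{2n}=\langle R,F \mid R^n=1,\ F^2=1,\ RF=FR^{n-1}\rangle$ denotes the dihedral group of order $2n$. *)

(* Defs.v *)
From HB Require Import structures.
From mathcomp Require Import all_boot all_order all_algebra all_fingroup.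
From mathcomp Require Import all_solvable.
From mathcomp Require Import boolp.

Set Implicit Arguments.
Unset Strict Implicit.
Unset Printing Implicit Defensive.

Import GRing.Theory.

(* Rows and columns are indexed by the same enumeration of [G]; only the values
   of [x] on [G] matter. *)
Definition group_det (R : comNzRingType) (gT : finGroupType) (G : {group gT})
    (x : gT -> R) : R :=
  \det (\matrix_(i < #|G|, j < #|G|)
          x (enum_val i * (enum_val j)^-1)%g)%R.

(* The Boolean form of "k >= 2 and k is the absolute value of an integer group
   determinant of G", as required by [ex_minn]. *)
Definition abs_group_det (gT : finGroupType) (G : {group gT}) : pred nat :=
  fun k => (2 <= k) && `[< exists x : gT -> int, absz (group_det G x) = k >].

Lemma abs_group_det_ex (gT : finGroupType) (G : {group gT}) :
  exists k, abs_group_det G k.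
Proof.
exists (2 ^ #|G|); apply/andP; split.
  by rewrite -{1}(expn1 2) leq_exp2l // cardG_gt0.
apply/asboolP; exists (fun g => if g == 1%g then Posz 2 else 0%R).
rewrite /group_det (_ : (\matrix_(i, j) _)%R = ((Posz 2)%:M)%R).
  by rewrite det_scalar abszX.
apply/matrixP => i j; rewrite !mxE -eq_mulgV1 (inj_eq enum_val_inj).
by case: eqP.
Qed.

Definition lambda (gT : finGroupType) (G : {group gT}) : nat :=
  ex_minn (abs_group_det_ex G).

(* [G] is the dihedral group of order [2 * n], given by its presentation. The
   library's ['D_(2 * n)] is only meaningful for [1 < n] (['D_2] has order 4),
   whereas [n = 1] is needed here. *)
Definition dihedral (n : nat) (gT : finGroupType) (G : {group gT}) : Prop :=
  (G \isog Grp (R : F : R ^+ n, F ^+ 2, R * F = F * R ^+ n.-1))%g.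

Lemma dihedralD n : 1 < n -> dihedral n 'D_((2 * n)%N)%G.
Proof.
move=> n_gt1 hT H; have n_gt0 := ltnW n_gt1.
have Dn := @Grp_dihedral n n_gt1; rewrite -mul2n in Dn.
rewrite (Dn hT H); apply/existsP/existsP=> [] [[x y]] /=;
  rewrite !xpair_eqE => /and4P[defH /eqP xn y2 /eqP xy];
  exists (x, y); rewrite /= !xpair_eqE defH xn y2 eqxx /=.
  have -> : (x ^+ n.-1)%g = (x^-1)%g.
    by apply/eqP; rewrite eq_sym eq_invg_mul -expgS prednK // xn.
  by rewrite -xy -conjgC.
have xV : (x ^+ n.-1)%g = (x^-1)%g.
  by apply/eqP; rewrite eq_sym eq_invg_mul -expgS prednK // xn.
by rewrite conjgE xy xV mulKg.
Qed.

Lemma dihedral1 : dihedral 1 [set: 'Z_2]%G.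
Proof.
apply: intro_isoGrp => [|hT H].
  apply/existsP; exists (1%g, Zp1 : 'Z_2); rewrite /= !xpair_eqE.
  apply/and4P; split=> //.
  by rewrite cycle1 joing1G Zp_cycle.
case/existsP=> -[x y]; rewrite /= !xpair_eqE => /and4P[/eqP defH /eqP x1 /eqP y2 _].
rewrite expg1 in x1; rewrite -defH x1 cycle1 joing1G.
apply/homgP.
have dvd : #[y]%g %| #[Zp1 : 'Z_2]%g by rewrite order_Zp1 order_dvdn y2.
have -> : [set: 'Z_2] = <[Zp1 : 'Z_2]>%g by rewrite -Zp_cycle.
exists (eltm_morphism dvd) => /=.
by rewrite morphim_cycle ?cycle_id //= eltm_id.
Qed.

(* Main.v *)
Require Import Defs.
From HB Require Import structures.
From mathcomp Require Import all_boot all_order all_algebra all_fingroup.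
From mathcomp Require Import all_solvable all_field ring zify.

(** Why the theorem holds.

    Write the elements of [D_2n] as [R^i] and [F R^i].  In this basis the group
    matrix is a two by two block matrix of commuting circulants, so the group
    determinants are exactly the integers
      [det (f(C^-1) f(C) - g(C^-1) g(C))],  [f, g] in [Z[X]],
    where [C] is the matrix of an [n]-cycle ([group_det_dihedral],
    [dihedral_values]); that is, the product over the [n]-th roots of unity
    [x] of [f(x^-1) f(x) - g(x^-1) g(x)].  Each factor is invariant under
    [x -> x^-1], hence equals [H(x + x^-1)] for one integer polynomial [H]
    ([autocorr]), and the product is the norm of [H] modulo the polynomial
    [chi n] whose roots are the [x + x^-1] ([dihedral_det_modnorm]).  The norm
    [modnorm Q H] is multiplicative in [Q] and, modulo a prime [p], depends on
    [Q] modulo [p] only; so divisibility of the determinant is read off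
    factorizations of [chi n], which is [V_n - 2] for the Dickson polynomial
    [V_n(x + x^-1) = x^n + x^-n].

    Lower bounds.  For an odd prime [p], [chi (p m) = chi m * W^2] with
    [W^2 = (chi m)^(p-1)] modulo [p].  So if [p] divides both [n] and the
    determinant, it divides the norms modulo [chi m] and modulo [W], the latter
    counted twice: [p^3] divides the determinant, and [p^5] if [p^2 | n].
    For [p = 2], [chi (2 m) = (V_m - 2) (V_m + 2)] and
    [chi (4 m) = (V_m - 2) (V_m + 2) V_m^2], with all factors equal modulo 2.
    A norm which is even although [H] has no root in F_2 is divisible by 4
    ([modnorm_dvd4]); if [H] has such a root, the factors
    [(t^2 - 4), (t^2 - 1)^2, (t^2 - 3)^2, t^2] of [chi 12] are examined by hand.
    The outcome is that an even determinant is divisible by 4, by 16 if [6 | n],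
    and by 256 if [12 | n].  Consequently, when [n] is divisible by all primes
    below the claimed value, the smallest prime factor of a smaller determinant
    already forces the determinant to exceed that value: this is where the
    bounds 4, 16, 27 and [p <= 113 < 5^3] come from.

    Upper bounds.  For [y = x^e] the choice [f = 1 + y + ... + y^k],
    [g = 1 + y + ... + y^(k-1)] turns the factor at [x] into a unit times
    [1 + y + ... + y^(2k)], and the product is [(2k+1)^e] when [e | n] and
    [2k+1] is prime to [n / e]: this gives every odd value ([e = 3] for 27,
    [e = 1] otherwise).  The choice [f = 1 + y], [g = 0] gives 4 ([e = 1], [n]
    odd) and 16 ([e = 2], [n / 2] odd). *)

Set Implicit Arguments.
Unset Strict Implicit.
Unset Printing Implicit Defensive.
Import Order.TTheory GRing.Theory Num.Theory.
Local Open Scope ring_scope.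

(** * Norms of integer polynomials modulo a monic polynomial *)

(** The evaluation of [H] at [M], for matrices of any size: [horner_mx] requires
    a nonzero size, but the cofactors of [chi d] in [chi n] may have degree 0.
    *)
Definition mxeval (R : comNzRingType) k (M : 'M[R]_k) (H : {poly R}) :
    'M[R]_k :=
  \sum_(i < size H) H`_i *: M ^+ i.

Lemma mxevalE (R : comNzRingType) k (M : 'M[R]_k.+1) H :
  mxeval M H = horner_mx M H.
Proof.
rewrite /mxeval -[H in RHS]coefK poly_def raddf_sum; apply: eq_bigr => i _ /=.
by rewrite linearZ rmorphXn /= horner_mx_X.
Qed.

(** The norm of [H] from [R[X] / (Q)] to [R], for monic [Q]; over a domain it is
    the resultant of [Q] and [H], the product of the [H(t)] over the roots [t]
    of [Q]. *)
Definition modnorm (R : comNzRingType) (Q H : {poly R}) : R :=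
  \det (mxeval (companionmx Q) H).

Lemma det_mxeval_map (R S : comNzRingType) (f : {rmorphism R -> S}) k
    (M : 'M[R]_k) H :
  f (\det (mxeval M H)) = \det (mxeval (map_mx f M) (map_poly f H)).
Proof.
case: k M => [|k] M; first by rewrite !det_mx00 rmorph1.
by rewrite !mxevalE -det_map_mx map_horner_mx.
Qed.

Lemma horner_char_poly (R : comNzRingType) k (M : 'M[R]_k) z :
  (char_poly M).[z] = \det (z%:M - M).
Proof.
rewrite /char_poly -[_.[z]]/(horner_eval z _) -det_map_mx; congr (\det _).
apply/matrixP=> i j; rewrite !mxE /= /horner_eval hornerD hornerN hornerC.
by rewrite hornerMn hornerX.
Qed.

(** Factoring [H], rather than the characteristic polynomial of [M], shows
    without any triangulation that [det H(M)] depends on [M] through its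
    characteristic polynomial only. *)
Lemma det_mxeval_root (F : comNzRingType) k (M : 'M[F]_k) H (a : F) r :
    H = a *: \prod_(z <- r) ('X - z%:P) ->
  \det (mxeval M H) = a ^+ k * \prod_(z <- r) ((- 1) ^+ k * (char_poly M).[z]).
Proof.
move=> ->.
have cpE := horner_char_poly M.
case: k M cpE => [|k] M cpE.
  rewrite det_mx00 expr0 mul1r big1 // => z _.
  by rewrite cpE det_mx00 mulr1.
rewrite mxevalE linearZ /= detZ rmorph_prod /=; congr (_ * _).
elim: r => [|z r IHr]; first by rewrite !big_nil det1.
rewrite !big_cons det_mulmx IHr; congr (_ * _).
rewrite rmorphB /= horner_mx_X horner_mx_C cpE -detZ scaleN1r opprB.
by [].
Qed.

Lemma modnorm_roots (F : comNzRingType) (Q H : {poly F}) (a : F) r :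
    Q \is monic -> H = a *: \prod_(z <- r) ('X - z%:P) ->
  modnorm Q H =
    a ^+ (size Q).-1 * \prod_(z <- r) ((- 1) ^+ (size Q).-1 * Q.[z]).
Proof. by rewrite /modnorm => Qm /det_mxeval_root->; rewrite companionmxK. Qed.

Lemma modnorm_map (R S : comNzRingType) (f : {rmorphism R -> S}) 
    (Q H : {poly R}) :
  Q \is monic -> f (modnorm Q H) = modnorm (map_poly f Q) (map_poly f H).
Proof.
move=> Qm; rewrite /modnorm det_mxeval_map.
have sQ : size (map_poly f Q) = size Q.
  by rewrite size_map_poly_id0 // (monicP Qm) rmorph1 oner_neq0.
have: forall i j, map_mx f (companionmx Q) i j =
    if i == (size (map_poly f Q)).-1.-1 :> nat then - (map_poly f Q)`_j
    else (i.+1 == j :> nat)%:R.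
  by move=> i j; rewrite !mxE sQ (fun_if f) rmorphN coef_map rmorph_nat.
move: (map_mx _ _); rewrite -sQ => M ME; congr (\det (mxeval _ _)).
by apply/matrixP=> i j; rewrite ME mxE.
Qed.

Lemma modnormM_closed (F : closedFieldType) (Q1 Q2 H : {poly F}) :
  Q1 \is monic -> Q2 \is monic ->
  modnorm (Q1 * Q2) H = modnorm Q1 H * modnorm Q2 H.
Proof.
move=> Q1m Q2m; have Qm : Q1 * Q2 \is monic by rewrite rpredM.
have [r Hr] := closed_field_poly_normal H.
rewrite !(modnorm_roots _ Hr) // size_monicM ?monic_neq0 //.
have s1 : (0 < size Q1)%N by rewrite size_poly_gt0 monic_neq0.
have s2 : (0 < size Q2)%N by rewrite size_poly_gt0 monic_neq0.
have -> : (size Q1 + size Q2).-1.-1 = ((size Q1).-1 + (size Q2).-1)%N by lia.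
rewrite exprD mulrACA -big_split /=; congr (_ * _); apply: eq_bigr => z _.
by rewrite hornerM exprD mulrACA.
Qed.

Lemma modnormM (Q1 Q2 H : {poly int}) :
  Q1 \is monic -> Q2 \is monic ->
  modnorm (Q1 * Q2) H = modnorm Q1 H * modnorm Q2 H.
Proof.
move=> Q1m Q2m; have Qm : Q1 * Q2 \is monic by rewrite rpredM.
apply: (@intr_inj algC); rewrite rmorphM /= !modnorm_map // rmorphM.
by rewrite modnormM_closed // monic_map.
Qed.

Lemma modnormX (Q H : {poly int}) k :
  Q \is monic -> modnorm (Q ^+ k) H = modnorm Q H ^+ k.
Proof.
move=> Qm; elim: k => [|k IHk].
  by rewrite !expr0 /modnorm; move: (companionmx _); rewrite size_poly1 => M;
     rewrite det_mx00.
by rewrite !exprS modnormM ?rpredX // IHk.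
Qed.

Lemma modnorm_XsubC (R : comNzRingType) (a : R) H :
  modnorm ('X - a%:P) H = H.[a].
Proof.
have := companionmxK (monicXsubC a); rewrite /modnorm.
move: (companionmx _); rewrite size_XsubC /= => M.
rewrite mxevalE [M]mx11_scalar; move: (M 0 0) => b /eqP.
rewrite /char_poly det_mx11 !mxE eqxx !mulr1n =>
  /eqP/addrI/oppr_inj/polyC_inj->.
elim/poly_ind: H => [|p c IH]; first by rewrite rmorph0 det0 horner0.
rewrite rmorphD rmorphM /= horner_mx_X horner_mx_C hornerMXaddC -IH.
by rewrite !det_mx11 !mxE big_ord1 !mxE eqxx !mulr1n.
Qed.

Lemma det_mxeval_modnorm k (M : 'M[int]_k) (Q H : {poly int}) :
    Q \is monic -> (size Q).-1 = k ->
    (forall z : algC,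
       (map_poly intr (char_poly M)).[z] = (map_poly intr Q).[z]) ->
  \det (mxeval M H) = modnorm Q H.
Proof.
move=> Qm sQ eqc; apply: (@intr_inj algC).
have [r Hr] := closed_field_poly_normal (map_poly intr H : {poly algC}).
rewrite modnorm_map // (modnorm_roots _ Hr) ?monic_map // det_mxeval_map.
rewrite (det_mxeval_root _ Hr) size_map_poly_id0 ?(monicP Qm) ?oner_neq0 // sQ.
by congr (_ * _); apply: eq_bigr => z _; rewrite -map_char_poly eqc.
Qed.

(** Both norms reduce to the same norm over the field [F_p]. *)
Lemma dvdz_modnorm_eqmod p (Q Q' H : {poly int}) :
    prime p -> Q \is monic -> Q' \is monic ->
    map_poly (intr : int -> 'F_p) Q = map_poly (intr : int -> 'F_p) Q' ->
  (p %| modnorm Q H)%Z = (p %| modnorm Q' H)%Z.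
Proof.
move=> p_pr Qm Q'm eqQ.
by rewrite !(dvdz_pcharf (pchar_Fp p_pr)) !modnorm_map // eqQ.
Qed.

(** Left multiplication by a lift of the inverse of the column basis of [M] mod
    [p] makes all rows beyond the rank divisible by [p]; such a lift has a
    determinant prime to [p]. *)
Lemma dvd_det_corank p n (M : 'M[int]_n) : prime p ->
  (Posz (p ^ (n - \rank (map_mx (intr : int -> 'F_p) M))) %| \det M)%Z.
Proof.
move=> p_pr; set Mp := map_mx _ M; set r := \rank Mp.
pose E := invmx (col_ebase Mp).
pose L : 'M[int]_n := map_mx (fun x : 'F_p => Posz (val x)) E.
have LE : map_mx (intr : int -> 'F_p) L = E.
  by apply/matrixP=> i j; rewrite !mxE -pmulrn natr_Zp.
pose d (i : 'I_n) : nat := if (i < r)%N then 1 else p.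
have rowsL (i j : 'I_n) : (d i %| (L *m M) i j)%Z.
  rewrite /d; case: ltnP => [_|le_ri]; first exact: dvd1z.
  rewrite (dvdz_pcharf (pchar_Fp p_pr)).
  have -> : ((L *m M) i j)%:~R = (map_mx (intr : int -> 'F_p) (L *m M)) i j.
    by rewrite [RHS]mxE.
  have -> : map_mx (intr : int -> 'F_p) (L *m M) = pid_mx r *m row_ebase Mp.
    rewrite map_mxM LE -/Mp -[X in _ *m X]mulmx_ebase -!mulmxA.
    by rewrite mulKmx // col_ebase_unit.
  rewrite mxE big1 // => k _; rewrite mxE ltnNge le_ri andbF mul0r //.
pose N : 'M[int]_n := \matrix_(i, j) ((L *m M) i j %/ d i)%Z.
have LM : L *m M = diag_mx (\row_i Posz (d i)) *m N.
  apply/matrixP=> i j; rewrite mul_diag_mx !mxE mulrC divzK //.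
  by have := rowsL i j; rewrite mxE.
have dvdLM : (Posz (p ^ (n - r)) %| \det L * \det M)%Z.
  rewrite -det_mulmx LM det_mulmx det_diag dvdz_mulr //.
  have -> : \prod_i (\row_i0 Posz (d i0)) 0 i = Posz (p ^ (n - r)).
    rewrite (eq_bigr (fun i : 'I_n => if (i < r)%N then 1 else Posz p)).
      2: by move=> i _; rewrite mxE /d; case: (i < r)%N.
    rewrite -(big_mkord xpredT (fun i => if (i < r)%N then 1 else Posz p)).
    rewrite (big_cat_nat (n := r)) ?rank_leq_row //=.
    rewrite big_nat big1 => [|i /andP[_ ->] //].
    rewrite mul1r big_nat (eq_bigr (fun=> Posz p)) => [|i /andP[+ _]].
      by rewrite -big_nat prodr_const_nat -[RHS]natz natrX natz.
    by rewrite leqNgt => /negPf ->.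
  exact: dvdzz.
rewrite Gauss_dvdzr // in dvdLM.
rewrite coprimezE /= coprimeXl // prime_coprime //.
have: \det E != 0 by rewrite -unitfE -unitmxE unitmx_inv col_ebase_unit.
by rewrite -LE det_map_mx -(dvdz_pcharf (pchar_Fp p_pr)).
Qed.

(** The kernel of [H(C)] over F_2, for [C] the companion matrix of [Q], is
    stable under [C]. If it were a line, [C] would act on it by some [a] in F_2,
    which would then be a root of [H]. So the corank is at least 2. *)
Lemma modnorm_dvd4 (Q H : {poly int}) :
    ~~ (2 %| H.[0])%Z -> ~~ (2 %| H.[1])%Z -> (2 %| modnorm Q H)%Z ->
  (4 %| modnorm Q H)%Z.
Proof.
rewrite /modnorm; move: (companionmx Q); case: (size Q).-1 => [|n] C.
  by rewrite det_mx00.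
move=> H0 H1; rewrite mxevalE (dvdz_pcharf (pchar_Fp (isT : prime 2))) => dM.
apply: dvdz_trans (dvd_det_corank _ (isT : prime 2)).
suffices r2 : (1 < n.+1 - \rank
  (map_mx (intr : int -> 'F_2) (horner_mx C H)))%N.
  by move: r2; case: (_ - _)%N => [|[|k]] // _;
    rewrite !expnS mulnA dvdzE /= dvdn_mulr.
rewrite map_horner_mx; rewrite -det_map_mx map_horner_mx in dM.
set Cp := map_mx _ C in dM *; set h := map_poly _ H in dM *.
rewrite -mxrank_ker; set K := kermx _.
have Kn0 : K != 0 by rewrite kermx_eq0 row_free_unit unitmxE unitfE dM.
have hN0 (a : 'F_2) : h.[a] != 0.
  have [->|->] : a = 0 \/ a = 1 by case: a => -[|[|//]] ?; [left|right];
    apply/val_inj.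
    by move: H0; rewrite (dvdz_pcharf (pchar_Fp (isT : prime 2))) -horner_map
      rmorph0.
  by move: H1; rewrite (dvdz_pcharf (pchar_Fp (isT : prime 2))) -horner_map
    rmorph1.
rewrite ltnNge; apply/negP => r1.
have K1 : \rank K = 1%N by apply/eqP; rewrite eqn_leq r1 lt0n mxrank_eq0.
have vn0 : nz_row K != 0 by rewrite nz_row_eq0.
set v := nz_row K in vn0.
have vK : (v <= K)%MS by apply: nz_row_sub.
have Kv : (K <= v)%MS.
  by rewrite -(mxrank_leqif_sup vK).2 K1 rank_rV vn0.
have /sub_rVP[a va] : (v *m Cp <= v)%MS.
  apply: submx_trans Kv; apply/sub_kermxP.
  have /sub_kermxP vh := vK.
  rewrite -mulmxA -[Cp *m _](comm_horner_mx) // mulmxA vh mul0mx //.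
have /sub_kermxP := vK.
have -> : v *m horner_mx Cp h = h.[a] *: v.
  elim/poly_ind: (h) => [|q c IHq];
    first by rewrite rmorph0 mulmx0 horner0 scale0r.
  rewrite rmorphD rmorphM /= horner_mx_X horner_mx_C mulmxDr hornerMXaddC.
  by rewrite mulmxA IHq -scalemxAl va scalerA scalerDl mul_mx_scalar.
by move/eqP; rewrite scaler_eq0 (negPf vn0) (negPf (hN0 _)).
Qed.

(** * Dickson polynomials and the factorizations of [chi] *)

(** Solutions of the recurrence satisfied by [x^n] and [x^-n] when
    [X = x + x^-1]. *)
Fixpoint lucas_seq (a b : {poly int}) n : {poly int} :=
  if n is m.+1 then
    if m is k.+1 then 'X * lucas_seq a b m - lucas_seq a b k else b
  else a.

(** The polynomial [V_n] with [V_n(x + x^-1) = x^n + x^-n]. *)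
Definition dickson := lucas_seq 2%:R 'X.

(** The polynomial with value [x^-k + ... + 1 + ... + x^k] at [x + x^-1] (the
    Dirichlet kernel). *)
Definition dirichlet := lucas_seq 1 ('X + 1).

Lemma lucas_seqSS a b n :
  lucas_seq a b n.+2 = 'X * lucas_seq a b n.+1 - lucas_seq a b n.
Proof. by []. Qed.

Lemma dicksonSS n : dickson n.+2 = 'X * dickson n.+1 - dickson n.
Proof. by []. Qed.
Lemma dirichletSS n : dirichlet n.+2 = 'X * dirichlet n.+1 - dirichlet n.
Proof. by []. Qed.
Lemma dickson0 : dickson 0 = 2%:R. Proof. by []. Qed.
Lemma dickson1 : dickson 1 = 'X. Proof. by []. Qed.
Lemma dirichlet0 : dirichlet 0 = 1. Proof. by []. Qed.
Lemma dirichlet1 : dirichlet 1 = 'X + 1. Proof. by []. Qed.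

Lemma size_lucas_seq (a b : {poly int}) :
    size b = 2%N -> b \is monic -> (size a <= 1)%N ->
  forall n, size (lucas_seq a b n.+1) = n.+2 /\ lucas_seq a b n.+1 \is monic.
Proof.
move=> sb mb sa n; suff : (size (lucas_seq a b n) <= n.+1)%N /\
  (size (lucas_seq a b n.+1) = n.+2 /\ lucas_seq a b n.+1 \is monic) by case.
elim: n => [//|n [IH1 [IH2 IH3]]]; split; first by rewrite IH2.
have sX : size ('X * lucas_seq a b n.+1) = n.+3.
  by rewrite mulrC size_mulX ?IH2 // monic_neq0.
rewrite lucas_seqSS; split.
  by rewrite size_polyDl ?sX // size_polyN (leq_ltn_trans IH1).
rewrite monicE lead_coefDl ?sX ?size_polyN ?(leq_ltn_trans IH1) //.
by rewrite -monicE monicMl ?monicX.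
Qed.

Lemma dickson_sum (A : nzRingType) (x y : A)
    (phi : {rmorphism {poly int} -> A}) n :
  x * y = 1 -> y * x = 1 -> phi 'X = x + y -> phi (dickson n) = x ^+ n + y ^+ n.
Proof.
move=> xy yx pX; have [] : phi (dickson n) = x ^+ n + y ^+ n /\
  phi (dickson n.+1) = x ^+ n.+1 + y ^+ n.+1; last by [].
elim: n => [|n [IH1 IH2]]; first by rewrite dickson0 dickson1 rmorph_nat.
split=> //; rewrite dicksonSS rmorphB rmorphM IH1 IH2 pX mulrDl !mulrDr.
have -> : x * y ^+ n.+1 = y ^+ n by rewrite exprS mulrA xy mul1r.
have -> : y * x ^+ n.+1 = x ^+ n by rewrite exprS mulrA yx mul1r.
apply/eqP; rewrite -!exprS subr_eq [X in X == _]addrACA [X in _ == X]addrACA.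
by rewrite [y ^+ n + _]addrC.
Qed.

Lemma dickson_mul b m :
  dickson (m + b + b) + dickson m = dickson b * dickson (m + b).
Proof.
pose P b := forall m,
  dickson (m + b + b) + dickson m = dickson b * dickson (m + b).
have [] : P b /\ P b.+1; last by [].
rewrite /P.
elim: b {m} => [|b [IH1 IH2]].
  by split=> m; rewrite ?addn0 ?addn1 ?dicksonSS ?dickson0 ?dickson1; ring.
split=> // m; have := IH2 m.+1; have := IH1 m.+2.
rewrite !addnS !addSn dicksonSS [dickson b.+2]dicksonSS.
rewrite [dickson (m + b).+2]dicksonSS => e1 e2.
rewrite [in RHS]mulrBl -[in RHS]mulrA -e2 -[dickson b * _]e1 ?dicksonSS.
by ring.
Qed.

(** At [x + x^-1] this says [x^(2k+1) + x^-(2k+1) - 2 = (x + x^-1 - 2) *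
    (x^-k + ... + x^k)^2].  The induction needs two companion identities, one of
    which is the quadratic invariant of the recurrence. *)
Lemma dickson_odd k : dickson k.*2.+1 - 2%:R = ('X - 2%:R) * dirichlet k ^+ 2.
Proof.
have [] : dirichlet k.+1 ^+ 2 - 'X * dirichlet k * dirichlet k.+1
          + dirichlet k ^+ 2 = 'X + 2%:R /\
  (dickson k.*2.+1 = ('X - 2%:R) * dirichlet k ^+ 2 + 2%:R /\
   dickson k.*2.+2 = ('X - 2%:R) * dirichlet k * dirichlet k.+1 + 'X);
     last first.
  by move=> _ [-> _]; ring.
elim: k => [|k [IH1 [IH2 IH3]]].
  by rewrite dicksonSS dickson0 dickson1 dirichlet0 dirichlet1; split; [|split];
    ring.
rewrite !doubleS.
have e3 : dickson k.*2.+3 = ('X - 2%:R) * dirichlet k.+1 ^+ 2 + 2%:R.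
  have -> : dirichlet k.+1 ^+ 2 = 'X + 2%:R + 'X * dirichlet k * dirichlet k.+1
    - dirichlet k ^+ 2.
    by rewrite -IH1; ring.
  by rewrite dicksonSS IH2 IH3; ring.
split; last split=> //.
  by rewrite dirichletSS -IH1; ring.
by rewrite dicksonSS e3 IH3 dirichletSS; ring.
Qed.

Lemma dickson_comp a b : dickson (a * b) = dickson a \Po dickson b.
Proof.
have [] : dickson (a * b) = dickson a \Po dickson b /\ dickson (a.+1 * b) =
  dickson a.+1 \Po dickson b; last by [].
elim: a => [|a [IH1 IH2]];
  first by rewrite mul1n dickson1 comp_polyX dickson0 rmorph_nat.
split=> //; rewrite dicksonSS rmorphB rmorphM /= comp_polyX -IH1 -IH2.
have := dickson_mul b (a * b); rewrite !mulSn ![(b + _)%N]addnC => <-.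
by rewrite addrK.
Qed.

(** The generic [t] is [x + y] for two mutually inverse matrices [x] and [y]
    over [F_p[t]], and Frobenius is additive on commuting elements:
    [x^p + y^p = (x + y)^p]. *)
Lemma dickson_prime_mod p : prime p ->
  map_poly (intr : int -> 'F_p) (dickson p) = 'X^p.
Proof.
move=> p_pr; set f := map_poly _.
pose t : {poly 'F_p} := 'X.
pose mx2 a b c d : 'M[{poly 'F_p}]_2 := \matrix_(i, j)
  if i == 0 then if j == 0 then a else b else if j == 0 then c else d.
(* the companion matrix of [Z^2 - t Z + 1] and its inverse *)
pose x := mx2 t (-1) 1 0; pose y := mx2 0 1 (-1) t.
have xy : x * y = 1.
  apply/matrixP=> -[[|[|//]] ?] -[[|[|//]] ?];
    by rewrite !mxE !big_ord_recl big_ord0 !mxE /=; ring.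
have yx : y * x = 1 by exact: mulmx1C.
have xDy : x + y = t%:M.
  by apply/matrixP=> -[[|[|//]] ?] -[[|[|//]] ?]; rewrite !mxE /=; ring.
have p_char : p \in [pchar 'M[{poly 'F_p}]_2].
  have pc : p \in [pchar {poly 'F_p}] by rewrite pchar_poly pchar_Fp.
  by rewrite inE p_pr -(rmorph_nat scalar_mx) (pcharf0 pc) raddf0 eqxx.
pose phi : {rmorphism {poly int} -> 'M[{poly 'F_p}]_2} := scalar_mx \o f.
have : phi (dickson p) = phi 'X ^+ p.
  rewrite (@dickson_sum _ x y) //; last by rewrite /phi /= /f map_polyX xDy.
  have -> : phi 'X = x + y by rewrite /phi /= /f map_polyX xDy.
  rewrite -!(pFrobenius_autE p_char) pFrobenius_autD_comm //.
  by rewrite /GRing.comm xy yx.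
rewrite -rmorphXn /phi /= => /(congr1 (fun M : 'M_2 => M 0 0)).
by rewrite !mxE eqxx !mulr1n rmorphXn /= map_polyX.
Qed.

(** The monic polynomial with roots [x + x^-1], [x] ranging over the [n]-th
    roots of unity; all roots but 2 and -2 are double. *)
Definition chi n : {poly int} := dickson n - 2%:R.

Lemma chi_monic n : (0 < n)%N -> chi n \is monic /\ size (chi n) = n.+1.
Proof.
case: n => // n _.
have sX : size ('X : {poly int}) = 2%N by rewrite size_polyX.
have [sV mV] := size_lucas_seq sX (monicX _) (size_polyC_leq1 2%:R) n.
rewrite polyC_natr -/dickson in sV mV.
have s2 : (size (- 2%:R : {poly int}) <= 1)%N.
  by rewrite size_polyN -polyC_natr size_polyC_leq1.
split; last by rewrite size_polyDl sV // (leq_ltn_trans s2).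
by rewrite monicE lead_coefDl ?sV ?(leq_ltn_trans s2).
Qed.

Lemma dickson_monic n :
  (0 < n)%N -> dickson n \is monic /\ size (dickson n) = n.+1.
Proof.
case: n => // n _.
have sX : size ('X : {poly int}) = 2%N by rewrite size_polyX.
have [] := size_lucas_seq sX (monicX _) (size_polyC_leq1 2%:R) n.
by rewrite polyC_natr.
Qed.

Lemma dirichlet_monic n : dirichlet n \is monic.
Proof.
case: n => [|n]; first by rewrite dirichlet0 monic1.
have sX : size ('X + 1 : {poly int}) = 2%N by rewrite size_XaddC.
by have [] := size_lucas_seq sX (monicXaddC _) (size_polyC_leq1 1) n.
Qed.

Lemma comp_monic (P Q : {poly int}) :
  P \is monic -> Q \is monic -> (1 < size Q)%N -> P \Po Q \is monic.
Proof.
move=> mP mQ sQ; rewrite monicE lead_coef_comp // (monicP mP) (monicP mQ).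
by rewrite expr1n mulr1.
Qed.

Lemma chi_mul_odd k m :
  chi (k.*2.+1 * m) = chi m * (dirichlet k \Po dickson m) ^+ 2.
Proof.
rewrite /chi dickson_comp;
  have := congr1 (fun P => P \Po dickson m) (dickson_odd k).
by rewrite !(rmorphM, rmorphB, rmorphXn) /= comp_polyX !rmorph_nat.
Qed.

Lemma chi_mul_prime_mod p m : prime p ->
  map_poly (intr : int -> 'F_p) (chi (p * m)) =
  map_poly (intr : int -> 'F_p) (chi m ^+ p).
Proof.
move=> p_pr; rewrite /chi dickson_comp !(rmorphB, rmorphXn) /= map_comp_poly.
rewrite dickson_prime_mod // rmorphXn /= comp_polyX !rmorph_nat.
have pc : p \in [pchar {poly 'F_p}] by rewrite pchar_poly pchar_Fp.
rewrite -!(pFrobenius_autE pc) pFrobenius_autB_comm ?pFrobenius_aut_nat //.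
exact: mulrC.
Qed.

(** Cancel [chi m] in [chi_mul_prime_mod]. *)
Lemma dirichlet_comp_mod k m : let p := k.*2.+1 in prime p -> (0 < m)%N ->
  map_poly (intr : int -> 'F_p) ((dirichlet k \Po dickson m) ^+ 2) =
  map_poly (intr : int -> 'F_p) (chi m ^+ p.-1).
Proof.
move=> p p_pr m_gt0.
have cm := (chi_monic m_gt0).1.
have := chi_mul_prime_mod m p_pr; rewrite {2}/p chi_mul_odd.
have -> : chi m ^+ p = chi m * chi m ^+ p.-1 by rewrite -exprS.
rewrite !rmorphM; apply: mulfI.
by rewrite monic_neq0 // monic_map.
Qed.

Lemma chi_double m : chi (2 * m) = (dickson m - 2%:R) * (dickson m + 2%:R).
Proof.
rewrite /chi dickson_comp dicksonSS dickson1 dickson0 rmorphB rmorphM /=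
  comp_polyX rmorph_nat.
by ring.
Qed.

Lemma chi_quad m :
  chi (4 * m) = (dickson m - 2%:R) * (dickson m + 2%:R) * dickson m ^+ 2.
Proof.
rewrite -[4%N]/(2 * 2)%N -mulnA chi_double dickson_comp dicksonSS dickson1
  dickson0.
by rewrite rmorphB rmorphM /= comp_polyX rmorph_nat; ring.
Qed.

(** [V_n = V_(n/d) o V_d], and [V_q(t) - 2] is divisible by [t - 2] since
    [V_q(2) = 2]. *)
Lemma chi_dvd d n : (0 < d)%N -> (0 < n)%N -> (d %| n)%N ->
  exists2 U, U \is monic & chi n = chi d * U.
Proof.
move=> d_gt0 n_gt0 /dvdnP[q def_n].
have q_gt0 : (0 < q)%N by move: n_gt0; rewrite def_n muln_gt0 => /andP[].
have V2 k : (dickson k).[2%:R] = 2%:R.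
  have [] : (dickson k).[2%:R] = 2%:R /\ (dickson k.+1).[2%:R] = 2%:R;
    last by [].
  elim: k => [|k [IH1 IH2]];
    first by rewrite dickson0 dickson1 hornerX -polyC_natr hornerC.
  by split=> //; rewrite dicksonSS !hornerE IH1 IH2.
have : root (dickson q - 2%:R) 2%:R.
  by rewrite rootE -polyC_natr !hornerE V2 subrr.
case/factor_theorem=> U0 defU.
have e : chi n = chi d * (U0 \Po dickson d).
  rewrite /chi def_n dickson_comp;
    have := congr1 (fun P => P \Po dickson d) defU.
  rewrite !(rmorphM, rmorphB) /= comp_polyX comp_polyC !rmorph_nat => ->.
  by rewrite mulrC.
exists (U0 \Po dickson d) => //.
by rewrite -(monicMl _ (chi_monic d_gt0).1) -e (chi_monic n_gt0).1.
Qed.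

Lemma chi2 : chi 2 = ('X - 2%:P) * ('X - (- 2)%:P).
Proof.
by rewrite /chi dicksonSS dickson1 dickson0 polyCN ?polyC_natr; ring.
Qed.

Lemma chi6 : chi 6 = chi 2 * (('X - 1%:P) * ('X - (-1)%:P)) ^+ 2.
Proof.
rewrite chi2 /chi !dicksonSS dickson1 dickson0 !polyCN polyC1 ?polyC_natr.
by ring.
Qed.

Lemma chi12 : chi 12 = chi 6 * ('X^2 - 3%:R) ^+ 2 * ('X - 0%:P) ^+ 2.
Proof.
rewrite chi6 chi2 /chi !dicksonSS dickson1 dickson0 !polyCN polyC1 polyC0.
by rewrite ?polyC_natr; ring.
Qed.

(** * Dihedral group determinants as circulant determinants *)

(** Any enumeration of [G] computes the group determinant, because rows and
    columns get permuted in the same way. *)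
Lemma group_det_enum (R : comNzRingType) (gT : finGroupType) (G : {group gT})
    (x : gT -> R) m (phi : 'I_m -> gT) :
    #|G| = m -> injective phi -> (forall i, phi i \in G) ->
  group_det G x = \det (\matrix_(i, j) x (phi i * (phi j)^-1)%g).
Proof.
move=> cG; case: m / cG in phi * => inj_phi Gphi.
pose s0 i := enum_rank_in (group1 G) (phi i).
have s0K i : enum_val (s0 i) = phi i by rewrite enum_rankK_in.
have inj_s0 : injective s0.
  by move=> i j /(congr1 enum_val); rewrite !s0K => /inj_phi.
pose s := perm inj_s0; rewrite /group_det; set M := \matrix_(i, j) _.
have -> : \matrix_(i, j) x (phi i * (phi j)^-1)%g = row_perm s (col_perm s M).
  by apply/matrixP=> i j; rewrite !mxE !permE !s0K.
rewrite row_permE col_permE !det_mulmx !det_perm mulrCA -signr_addb.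
by rewrite odd_permV addbb mulr1.
Qed.

(** The presentation determines [G] up to isomorphism, so its order can be read
    on the known models. *)
Lemma card_dihedral_group n (gT : finGroupType) (G : {group gT}) :
  (0 < n)%N -> dihedral n G -> #|G| = (2 * n)%N.
Proof.
move=> n_gt0 dihG.
have isoD rT (D : {group rT}) : dihedral n D -> #|G| = #|D|.
  move=> dihD; apply: card_isog; rewrite isogEhom.
  have hD : (D \homg G)%g by rewrite (dihG _ D) -(dihD _ D) homg_refl.
  have hG : (G \homg D)%g by rewrite (dihD _ G) -(dihG _ G) homg_refl.
  by rewrite hD hG.
case: n n_gt0 dihG isoD => [//|[|n]] _ dihG isoD.
  by rewrite (isoD _ _ dihedral1) cardsT card_ord.
have := @card_dihedral n.+2 isT; rewrite -mul2n => <-.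
exact: isoD (@dihedralD n.+2 isT).
Qed.

(** The presentation gives generators with the right relations; counting in
    [G = <r> <s>] shows that the orders of [r] and [s] do not drop and that the
    two cyclic subgroups meet trivially. *)
Lemma dihedral_gens n (gT : finGroupType) (G : {group gT}) :
    (0 < n)%N -> dihedral n G ->
  exists r s : gT, [/\ r \in G /\ s \in G, (s ^+ 2 = 1)%g, (s * r * s = r^-1)%g,
    #[r]%g = n & s \notin <[r]>%g].
Proof.
move=> n_gt0 dihG; have cG := card_dihedral_group n_gt0 dihG.
have : (G \homg Grp (R : F : R ^+ n, F ^+ 2, R * F = F * R ^+ n.-1))%g.
  by rewrite -(dihG _ G) homg_refl.
case/existsP=> -[r s]; rewrite /= !xpair_eqE.
case/and4P=> /eqP defG /eqP rn /eqP s2 /eqP rs.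
have rV : (r ^+ n.-1 = r^-1)%g.
  by apply/eqP; rewrite eq_sym eq_invg_mul -expgS prednK // rn.
have srs : (s * r * s = r^-1)%g.
  by rewrite -mulgA rs rV mulgA -expg2 s2 mul1g.
have sV : (s^-1 = s)%g by apply/eqP; rewrite eq_invg_mul -expg2 s2.
exists r, s.
have Gr : r \in G by rewrite -defG mem_gen // inE cycle_id.
have Gs : s \in G by rewrite -defG mem_gen // inE cycle_id orbT.
have nrs : (<[s]> \subset 'N(<[r]>))%g.
  rewrite cycle_subG; apply/normP; rewrite -cycleJ conjgE sV mulgA srs.
  exact: cycleV.
have cGrs : #|(<[r]> * <[s]>)%g| = (2 * n)%N.
  by rewrite -cG -defG /= norm_joinEr.
have e := mul_cardG <[r]>%G <[s]>%G; rewrite /= cGrs -!orderE in e.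
have dr : (#[r]%g <= n)%N by rewrite dvdn_leq // order_dvdn rn.
have ds : (#[s]%g <= 2)%N by rewrite dvdn_leq // order_dvdn s2.
have I_gt0 : (0 < #|(<[r]> :&: <[s]>)%g|)%N by rewrite cardG_gt0.
have [or os k1] : [/\ #[r]%g = n, #[s]%g = 2%N & #|(<[r]> :&: <[s]>)%g| = 1%N].
  move: #|(<[r]> :&: <[s]>)%g| (#[r]%g) (#[s]%g) dr ds I_gt0 e => k a b dr ds
    k_gt0 e.
  have le1 : (a * b <= n * 2)%N by rewrite leq_mul.
  have k1 : k = 1%N by nia.
  have a_ge : (n <= a)%N by nia.
  by split=> //; nia.
split=> //; apply/negP => srC.
have : (#[s]%g <= 1)%N.
  by rewrite orderE -[X in (_ <= X)%N]k1 subset_leq_card // subsetI cycle_subG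
    srC subxx.
by rewrite os.
Qed.

(** When [det D] is cancellable this follows by multiplying on the right by the
    block matrix with rows [D, 0] and [- C, 1].  Replacing [D] by [X + D] over
    [R[X]] makes the determinant monic, and [X = 0] recovers the statement. *)
Lemma det_block_comm (R : idomainType) n (A B C D : 'M[R]_n) :
  C *m D = D *m C -> \det (block_mx A B C D) = \det (A *m D - B *m C).
Proof.
move=> CD.
pose ev0 : {rmorphism {poly R} -> R} := horner_eval 0.
pose lift (M : 'M[R]_n) := map_mx (@polyC R) M.
(* [X + D], whose determinant is monic *)
pose DX : 'M[{poly R}]_n := char_poly_mx (- D).
have liftK M : map_mx ev0 (lift M) = M.
  by apply/matrixP=> i j; rewrite !mxE /= /horner_eval hornerC.
have DXE : DX = 'X%:M + lift D by rewrite /DX /char_poly_mx map_mxN opprK.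
have DX0 : map_mx ev0 DX = D.
  rewrite DXE map_mxD liftK map_scalar_mx /= /horner_eval hornerX.
  by rewrite raddf0 add0r.
have CDX : lift C *m DX = DX *m lift C.
  by rewrite DXE mulmxDl mulmxDr scalar_mxC -!map_mxM CD.
have nzDX : \det DX != 0 by rewrite monic_neq0 // char_poly_monic.
pose P := lift A *m DX - lift B *m lift C.
have : \det (block_mx (lift A) (lift B) (lift C) DX) * \det DX = \det P * \det
  DX.
  transitivity (\det (block_mx (lift A) (lift B) (lift C) DX *m
                      block_mx DX 0 (- lift C) 1%:M)).
    by rewrite det_mulmx det_lblock det1 mulr1.
  rewrite mulmx_block !mulmxN !mulmx0 !mulmx1 !add0r CDX subrr det_ublock.
  by [].
move=> /(mulIf nzDX) /(congr1 ev0);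
  rewrite -!det_map_mx map_block_mx DX0 !liftK.
by rewrite map_mxB !map_mxM DX0 !liftK.
Qed.

Section Cycle.
Variable n' : nat.
Local Notation n := n'.+1.

(** The permutation matrix of the cycle [i -> i + 1] modulo [n]. *)
Definition cyc : 'M[int]_n := \matrix_(i, j) ((j : nat) == i.+1 %% n)%N%:R.

Lemma cycX k i j : (cyc ^+ k) i j = ((j : nat) == (i + k) %% n)%N%:R.
Proof.
elim: k i => [|k IHk] i; first by rewrite !mxE addn0 modn_small // eq_sym.
rewrite exprS mxE (bigD1 (inord (i.+1 %% n)%N)) //= big1 ?addr0 => [|l nel].
  rewrite mxE inordK ?ltn_pmod // eqxx mul1r IHk inordK ?ltn_pmod //.
  by rewrite modnDml addSnnS.
rewrite mxE; case: eqP => [el|_]; last by rewrite mul0r.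
by case/eqP: nel; apply: val_inj; rewrite /= inordK ?ltn_pmod.
Qed.

Lemma horner_cycE f i j :
  horner_mx cyc f i j = \sum_(k < size f | ((j : nat) == (i + k) %% n)%N) f`_k.
Proof.
rewrite -mxevalE /mxeval summxE [RHS]big_mkcond; apply: eq_bigr => k _.
by rewrite mxE cycX; case: eqP; rewrite ?mulr1 ?mulr0.
Qed.

Lemma horner_cyc_shift f (i j : 'I_n) (m : nat) :
  (j = i + m %[mod n])%N -> (m < n)%N ->
  horner_mx cyc f i j = horner_mx cyc f 0 (inord m).
Proof.
move=> ji lt_mn; rewrite !horner_cycE; apply: eq_bigl => k.
rewrite inordK // add0n -(modn_small (ltn_ord j)) ji eqn_modDl.
by rewrite modn_small.
Qed.

Lemma horner_cyc_poly (a : nat -> int) (m : nat) : (m < n)%N ->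
  horner_mx cyc (\poly_(k < n) a k) 0 (inord m) = a m.
Proof.
move=> lt_mn; rewrite poly_def raddf_sum summxE.
rewrite (eq_bigr (fun k : 'I_n => if k == Ordinal lt_mn then a m else 0)).
  by rewrite -big_mkcond big_pred1_eq.
move=> k _ /=; rewrite horner_mxZ rmorphXn /= horner_mx_X mxE cycX inordK //.
rewrite add0n modn_small // eq_sym -val_eqE /=.
by case: eqP => [->|]; rewrite ?mulr1 ?mulr0.
Qed.

Lemma horner_mx_tr (M : 'M[int]_n) f : horner_mx M^T f = (horner_mx M f)^T.
Proof.
rewrite -!mxevalE /mxeval raddf_sum; apply: eq_bigr => k _.
rewrite /= [RHS]linearZ /=; congr (_ *: _).
by elim: (val k) => [|l IHl]; rewrite ?trmx1 // exprS exprSr trmx_mul IHl.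
Qed.

(** The product over the [n]-th roots of unity [x] of
    [f(x^-1) f(x) - g(x^-1) g(x)], since the transpose of [cyc] is its
    inverse. *)
Definition dihedral_det (f g : {poly int}) : int :=
  \det (horner_mx cyc^T f *m horner_mx cyc f
        - horner_mx cyc^T g *m horner_mx cyc g).

Variables (gT : finGroupType) (G : {group gT}).
Hypothesis dihG : dihedral n G.

(** With rows and columns enumerated as [r^i], then [s r^i = r^-i s], every
    block of the group matrix is circulant. *)
Lemma group_det_dihedral (r s : gT) (x : gT -> int) (f g : {poly int}) :
    r \in G -> s \in G -> (s ^+ 2 = 1)%g -> (s * r * s = r^-1)%g ->
    #[r]%g = n -> s \notin <[r]>%g ->
    (forall k, (k < n)%N -> x (r ^+ k)%g = horner_mx cyc f 0 (inord k)) ->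
    (forall k, (k < n)%N -> x (r ^+ k * s)%g = horner_mx cyc g 0 (inord k)) ->
  group_det G x = dihedral_det f g.
Proof.
move=> Gr Gs s2 srs or nsr xf xg.
have sV : (s^-1 = s)%g by apply/eqP; rewrite eq_invg_mul -expg2 s2.
have srX k : (s * r ^+ k = r ^- k * s)%g.
  have sr : (s * r = r^-1 * s)%g by rewrite -srs -mulgA -expg2 s2 mulg1.
  rewrite -expgVn; elim: k => [|k IHk]; first by rewrite mulg1 mul1g.
  by rewrite expgSr mulgA IHk -mulgA sr mulgA -expgSr.
have srXX k l : (s * r ^+ k * r ^- l = r ^+ l * r ^- k * s)%g.
  rewrite srX -mulgA; have -> : (s * r ^- l = r ^+ l * s)%g.
    by apply: (mulIg (r ^+ l)%g); rewrite mulgKV -mulgA srX mulKVg.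
  rewrite !mulgA; congr (_ * _)%g.
  exact/commute_sym/commuteV/commuteX2.
pose phi (u : 'I_(n + n)) : gT :=
  match split u with inl i => (r ^+ i)%g | inr i => (s * r ^+ i)%g end.
have cG := card_dihedral_group (isT : (0 < n)%N) dihG.
have r_inj : {in gtn n &, injective (expgn r)}.
  move=> i j lti ltj /eqP; rewrite eq_expg_mod_order or !modn_small //.
  by move/eqP.
have phi_inj : injective phi.
  move=> u v; rewrite -[u]splitK -[v]splitK /phi !unsplitK.
  case: (split u) (split v) => i [] j //=.
  - by move/r_inj => /(_ (ltn_ord i) (ltn_ord j))/val_inj->.
  - by move=> e; case/negP: nsr;
      rewrite -(mulgK (r ^+ j)%g s) -e groupM ?groupV ?mem_cycle.
  - by move=> e; case/negP: nsr;
      rewrite -(mulgK (r ^+ i)%g s) e groupM ?groupV ?mem_cycle.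
  - by move/mulgI/r_inj => /(_ (ltn_ord i) (ltn_ord j))/val_inj->.
have Gphi u : phi u \in G.
  by rewrite /phi; case: (split u) => i; rewrite ?groupM ?groupX.
rewrite (group_det_enum x _ phi_inj Gphi) ?cG ?mul2n ?addnn //.
have rB (i j : 'I_n) (y : gT) :
    (r ^+ i * r ^- j * y = r ^+ ((i + (n - j)) %% n)%N * y)%g.
  have rn : (r ^+ n = 1)%g by rewrite -or expg_order.
  rewrite expg_mod // expgD; congr (_ * _ * _)%g; apply: (mulIg (r ^+ j)%g).
  by rewrite mulVg -expgD subnK // ltnW.
have mo (i j : 'I_n) : (i = j + (i + (n - j)) %% n %[mod n])%N.
  by rewrite modnDmr addnCA subnKC ?modnDr // ltnW.
have lt (i j : 'I_n) : ((i + (n - j)) %% n < n)%N by rewrite ltn_pmod.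
set M := \matrix_(i, j) _.
have -> : M = block_mx (horner_mx cyc^T f) (horner_mx cyc^T g)
                       (horner_mx cyc g) (horner_mx cyc f).
  rewrite -[M]submxK; congr block_mx; apply/matrixP=> i j;
  rewrite ?horner_mx_tr !mxE /phi ?(unsplitK (inl _)) ?(unsplitK (inr _)).
  - by rewrite -[(_ * _)%g]mulg1 rB mulg1 xf // (horner_cyc_shift _ (mo i j)).
  - rewrite invMg sV mulgA rB xg //  (horner_cyc_shift _ (mo i j)) //.
  - rewrite srXX -[(_ * s)%g]mulgA mulgA rB xg // (horner_cyc_shift _ (mo j i))
      //.
  - rewrite invMg sV mulgA srXX -mulgA -expg2 s2 rB mulg1 xf //.
    by rewrite (horner_cyc_shift _ (mo j i)).
by rewrite det_block_comm //; apply: comm_horner_mx2.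
Qed.

Lemma dihedral_values k :
  (exists x : gT -> int, absz (group_det G x) = k) <->
  (exists f g : {poly int}, absz (dihedral_det f g) = k).
Proof.
have [r [s [[Gr Gs] s2 srs or nsr]]] := dihedral_gens (isT : (0 < n)%N) dihG.
have detE := group_det_dihedral Gr Gs s2 srs or nsr.
split=> [[x <-]|[f [g <-]]].
  exists (\poly_(k < n) x (r ^+ k)%g), (\poly_(k < n) x (r ^+ k * s)%g).
  rewrite (@detE x (\poly_(k < n) x (r ^+ k)%g)
    (\poly_(k < n) x (r ^+ k * s)%g)) //.
    by move=> l lt_ln; rewrite horner_cyc_poly.
  by move=> l lt_ln; rewrite (horner_cyc_poly (fun l => x (r ^+ l * s)%g)).
pose log (y : gT) : 'I_n := odflt 0 [pick l : 'I_n | (r ^+ l)%g == y].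
have logK l : (l < n)%N -> log (r ^+ l)%g = inord l.
  move=> lt_ln; rewrite /log; case: pickP => [m|/(_ (inord l))] /=.
    rewrite eq_expg_mod_order or !modn_small // => /eqP ml.
    by apply: val_inj; rewrite /= inordK.
  by rewrite inordK // eqxx.
pose x y := if y \in <[r]>%g then horner_mx cyc f 0 (log y)
            else horner_mx cyc g 0 (log (y * s^-1)%g).
exists x; rewrite (detE x f g) // => l lt_ln; rewrite /x.
  by rewrite mem_cycle logK.
by rewrite groupMl ?mem_cycle // (negPf nsr) mulgK logK.
Qed.
End Cycle.

(** * Reduction to a norm modulo [chi n] *)

(** [H(x + y) = f(x) f(y)] for mutually inverse [x] and [y].  Quantifying over
    all ring morphisms out of [Z[X]] covers at once evaluations at matrices, at
    integers and at complex numbers. *)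
Definition is_autocorr (f H : {poly int}) :=
  forall (A : nzRingType) (px py pt : {rmorphism {poly int} -> A}),
    px 'X * py 'X = 1 -> py 'X * px 'X = 1 -> pt 'X = px 'X + py 'X ->
  px f * py f = pt H.

Lemma autocorr_linear f k : exists L,
  forall (A : nzRingType) (px py pt : {rmorphism {poly int} -> A}),
    px 'X * py 'X = 1 -> py 'X * px 'X = 1 -> pt 'X = px 'X + py 'X ->
  px f * px 'X ^+ k + py f * py 'X ^+ k = pt L.
Proof.
elim/poly_ind: f k => [|f c IHf] k.
  by exists 0 => A px py pt _ _ _; rewrite !raddf0 !mul0r addr0.
have [L HL] := IHf k.+1; exists (L + c%:P * dickson k) => A px py pt xy yx pX.
rewrite !rmorphD !rmorphM /= -(HL A px py pt) // (dickson_sum k xy yx pX).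
rewrite -[c]intz !rmorph_int !mulrDl -!mulrA -!exprS mulrDr.
by rewrite [LHS]addrACA.
Qed.

(** Expanding [f(x) f(y)] leaves constants and sums [x^k + y^k], which are
    values of Dickson polynomials at [x + y]. *)
Lemma autocorr f : exists H, is_autocorr f H.
Proof.
elim/poly_ind: f => [|f c [H IHf]].
  by exists 0 => A px py pt _ _ _; rewrite !raddf0 mul0r.
have [L HL] := autocorr_linear f 1.
exists (H + c%:P * L + (c * c)%:P) => A px py pt xy yx pX.
have fX : py (f * 'X) = py 'X * py f by rewrite mulrC rmorphM.
have e : px f * px 'X * py (f * 'X) = px f * py f.
  by rewrite fX -mulrA (mulrA (px 'X)) xy mul1r.
rewrite !rmorphD mulrDl !mulrDr [X in X * py (f * 'X)]rmorphM e.
rewrite (IHf _ _ _ pt) // [pt (_ * L)]rmorphM -(HL A px py pt) //.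
rewrite -[c]intz polyCM !rmorphM !rmorph_int !expr1 mulrDr -!addrA.
congr (_ + _); rewrite !addrA; congr (_ + _).
by rewrite [in LHS]commr_int.
Qed.

Section Circulant.
Variable n' : nat.
Local Notation n := n'.+1.
Local Notation C := (cyc n').
Local Notation toC := (map_poly (intr : int -> algC)).

Lemma cyc_mul_tr : C *m C^T = 1.
Proof.
apply/matrixP=> i j; rewrite !mxE (bigD1 (inord (i.+1 %% n)%N)) //= big1.
  rewrite !mxE inordK ?ltn_pmod // eqxx mul1r addr0 /=.
  have -> // : (i.+1 == j.+1 %[mod n])%N = (i == j).
  by rewrite -[i.+1]add1n -[j.+1]add1n eqn_modDl !modn_small.
move=> k nek; rewrite !mxE; case: eqP => [ek|_]; last by rewrite mul0r.
by case/eqP: nek; apply: val_inj; rewrite /= inordK ?ltn_pmod.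
Qed.

Lemma cyc_tr_mul : C^T *m C = 1.
Proof. by have := mulmx1C cyc_mul_tr. Qed.

(** [cyc] is the companion matrix of [X^n - 1]. *)
Lemma char_poly_cyc : char_poly C = 'X^n - 1.
Proof.
have Qm : ('X^n - 1 : {poly int}) \is monic by apply: monicXnsubC.
rewrite -[RHS]companionmxK //.
have sQ : (size ('X^n - 1 : {poly int})).-1 = n by rewrite size_XnsubC.
have: forall i j : 'I_(size ('X^n - 1 : {poly int})).-1,
    companionmx ('X^n - 1 : {poly int}) i j = ((j : nat) == i.+1 %% n)%N%:R.
  move=> i j; rewrite mxE.
  have li : (i < n)%N by have := ltn_ord i; rewrite [X in (_ < X)%N]sQ.
  have lj : (j < n)%N by have := ltn_ord j; rewrite [X in (_ < X)%N]sQ.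
  rewrite [in X in i == X :> nat]sQ /= coefB coefXn coef1 (ltn_eqF lj) sub0r
    opprK.
  case: eqP => [->|ne]; first by rewrite modnn.
  rewrite modn_small 1?eq_sym // ltn_neqAle li andbT.
  by apply/eqP => -[].
move: (companionmx _); rewrite sQ => M ME; congr (char_poly _).
by apply/matrixP=> i j; rewrite ME mxE.
Qed.

(** The determinant is [det H(T)] with [T = C + C^T], so it remains to compare
    the characteristic polynomial of [T] with [chi n].  At [b = x + x^-1], using
    [C C^T = 1], one has [x (b - T) = (x - C) (x - C^T)]; hence both polynomials
    take the value [(x^n - 1)^2 / x^n]. *)
Lemma dihedral_det_modnorm (f g Hf Hg : {poly int}) :
    is_autocorr f Hf -> is_autocorr g Hg ->
  dihedral_det n' f g = modnorm (chi n) (Hf - Hg).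
Proof.
move=> cf cg; pose T := C^T + C.
have hT (P HP : {poly int}) : is_autocorr P HP ->
    horner_mx C^T P *m horner_mx C P = horner_mx T HP.
  move=> cP; apply: cP; rewrite /= !horner_mx_X.
  - exact: cyc_tr_mul.
  - exact: cyc_mul_tr.
  - by [].
rewrite /dihedral_det (hT _ _ cf) (hT _ _ cg) -rmorphB /= -mxevalE.
have [cm sc] := chi_monic (isT : (0 < n)%N).
apply: det_mxeval_modnorm => //; first by rewrite sc.
(* every complex number is of the form [x + x^-1] *)
move=> b; have [x x_nz def_b] : exists2 x : algC, x != 0 & b = x + x^-1.
  have [x ex] := @solve_monicpoly algC 2 (nth 0 [:: -1; b]) isT.
  rewrite !big_ord_recl big_ord0 /= expr0 expr1 mulr1 addr0 in ex.
  have x_nz : x != 0.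
    apply/eqP => x0; move: ex; rewrite x0 expr0n mulr0 addr0 => /eqP.
    by rewrite eq_sym oppr_eq0 oner_eq0.
  exists x => //; apply: (mulIf x_nz); rewrite mulrDl mulVf // -expr2 ex; ring.
apply: (@mulfI _ (x ^+ n)); first by rewrite expf_neq0.
transitivity ((x ^+ n - 1) ^+ 2).
  pose Ca : 'M[algC]_n := map_mx intr C.
  rewrite map_char_poly horner_char_poly -detZ.
  have CCt : Ca *m Ca^T = 1%:M.
    by rewrite /Ca map_trmx -[map_mx _ C *m _]map_mxM cyc_mul_tr map_mx1.
  have -> : x *: (b%:M - map_mx intr T) = (x%:M - Ca) *m (x%:M - Ca^T).
    rewrite mulmxBl !mulmxBr !mul_scalar_mx mul_mx_scalar CCt scale_scalar_mx.
    rewrite map_mxD -map_trmx -/Ca scalerBr scalerDr scale_scalar_mx def_b.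
    rewrite mulrDr mulfV // [(_ + _)%:M]raddfD /= opprB opprD -!addrA.
    by congr (_ + _); rewrite addrCA.
  rewrite det_mulmx.
  have -> : \det (x%:M - Ca^T) = \det (x%:M - Ca).
    by rewrite -det_tr linearB /= trmxK tr_scalar_mx.
  by rewrite -horner_char_poly -map_char_poly char_poly_cyc rmorphB rmorph1 /=
    map_polyXn !hornerE expr2.
rewrite /chi rmorphB rmorph_nat hornerD hornerN.
have -> : (toC (dickson n)).[b] = x ^+ n + x^-1 ^+ n.
  apply: (@dickson_sum _ x x^-1 (horner_eval b \o toC));
    rewrite ?mulfV ?mulVf //.
  by rewrite /= /horner_eval map_polyX hornerX.
rewrite -polyC_natr hornerC mulrDr mulrDr exprVn mulfV ?expf_neq0 //; ring.
Qed.
End Circulant.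

(** * Divisibility properties of dihedral determinants *)

Lemma prime_dvdzM p (a b : int) : prime p ->
  (p %| a * b)%Z = (p %| a)%Z || (p %| b)%Z.
Proof. by move=> p_pr; rewrite !dvdzE abszM Euclid_dvdM. Qed.

Lemma prime_dvdzX p (a : int) k : prime p -> (p %| a ^+ k.+1)%Z = (p %| a)%Z.
Proof. by move=> p_pr; rewrite !dvdzE abszX Euclid_dvdX // andbT. Qed.

(** [chi (p m) = chi m * W^2], where [chi (p m) = chi m ^ p] and
    [W^2 = chi m ^ (p - 1)] modulo [p]: the three norms are divisible by [p] at
    the same time. *)
Lemma modnorm_chi_odd_prime p m (H : {poly int}) :
    prime p -> odd p -> (0 < m)%N ->
    (p %| modnorm (chi (p * m)) H)%Z ->
  (p %| modnorm (chi m) H)%Z /\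
  (Posz (p ^ 2) * modnorm (chi m) H %| modnorm (chi (p * m)) H)%Z.
Proof.
move=> p_pr p_odd m_gt0 dvd_p; have p_gt1 := prime_gt1 p_pr.
have [cm _] := chi_monic m_gt0.
have [cpm _] : chi (p * m) \is monic /\ _ := chi_monic (ltac:(lia) :
  (0 < p * m)%N).
have [k def_p] : exists k, p = k.*2.+1.
  by exists p./2; rewrite -add1n -[LHS]odd_double_half p_odd.
have Wm : dirichlet k \Po dickson m \is monic.
  have [Vm sV] := dickson_monic m_gt0.
  by rewrite comp_monic ?dirichlet_monic // sV.
have dvd_m : (p %| modnorm (chi m) H)%Z.
  move: dvd_p; rewrite (@dvdz_modnorm_eqmod _ _ (chi m ^+ p)) ?rpredX //;
    last first.
    exact: chi_mul_prime_mod.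
  by rewrite modnormX // -(prednK (prime_gt0 p_pr)) prime_dvdzX // prednK
    ?prime_gt0.
have -> : chi (p * m) = chi m * (dirichlet k \Po dickson m) ^+ 2 by rewrite
  def_p chi_mul_odd.
split=> //; rewrite modnormM ?rpredX // mulrC dvdz_mul //.
have : (p %| modnorm ((dirichlet k \Po dickson m) ^+ 2) H)%Z.
  rewrite (@dvdz_modnorm_eqmod _ _ (chi m ^+ p.-1)) ?rpredX //; last first.
    by move: p_pr; rewrite def_p => p_pr; exact: dirichlet_comp_mod.
  rewrite modnormX //; case: (p) p_gt1 dvd_m => [|[|q]] //= _ dm.
  by rewrite exprS dvdz_mulr.
rewrite modnormX // prime_dvdzX // !dvdzE abszX /= => d.
by rewrite dvdn_exp2r.
Qed.

Lemma dvdz_odd_prime p n (H : {poly int}) : prime p -> odd p -> (0 < n)%N ->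
    (p %| n)%N -> (p %| modnorm (chi n) H)%Z ->
  (Posz (p ^ 3) %| modnorm (chi n) H)%Z.
Proof.
move=> p_pr p_odd n_gt0 /dvdnP[m def_n]; rewrite mulnC in def_n.
move: n_gt0; rewrite def_n muln_gt0 => /andP[_ m_gt0].
move/(modnorm_chi_odd_prime p_pr p_odd m_gt0) => [dm]; apply: dvdz_trans.
by rewrite (expnSr p 2) PoszM dvdz_mul.
Qed.

Lemma dvdz_odd_prime2 p n (H : {poly int}) : prime p -> odd p -> (0 < n)%N ->
    (p ^ 2 %| n)%N -> (p %| modnorm (chi n) H)%Z ->
  (Posz (p ^ 5) %| modnorm (chi n) H)%Z.
Proof.
move=> p_pr p_odd n_gt0 /dvdnP[m def_n].
have {}def_n : n = (p * (p * m))%N by rewrite def_n mulnC mulnA.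
move: n_gt0; rewrite def_n !muln_gt0 => /and3P[p_gt0 _ m_gt0].
move/(modnorm_chi_odd_prime p_pr p_odd (ltac:(lia) : (0 < p * m)%N)) => [dm].
apply: dvdz_trans; rewrite (expnD p 2 3) PoszM dvdz_mul //.
by apply: dvdz_odd_prime => //; [lia | rewrite dvdn_mulr].
Qed.

Lemma autocorr2 f Hf : is_autocorr f Hf -> Hf.[2] = f.[1] ^+ 2.
Proof.
move=> cf; have := cf int (horner_eval 1) (horner_eval 1) (horner_eval 2).
by rewrite /= /horner_eval !hornerX => <- //; rewrite mulr1.
Qed.

Lemma autocorrN2 f Hf : is_autocorr f Hf -> Hf.[-2] = f.[-1] ^+ 2.
Proof.
move=> cf; have := cf int (horner_eval (-1)) (horner_eval (-1)) (horner_eval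
  (-2)).
by rewrite /= /horner_eval !hornerX => <- //.
Qed.

(** The values of [H] at 2, -2 and 0 are those of [f(x) f(x^-1)] at 1, -1 and
    ['i].  Here [s] and [t] are the sums of the even and of the odd coefficients
    of [f]; alternating the signs within each sum, as [f('i)] does, preserves
    parity. *)
Lemma autocorr_at4 f Hf : is_autocorr f Hf -> exists s t p q : int,
  [/\ Hf.[2] = (s + t) ^+ 2, Hf.[-2] = (s - t) ^+ 2 &
      Hf.[0] = (s + 2 * p) ^+ 2 + (t + 2 * q) ^+ 2].
Proof.
move=> cf; pose toC := map_poly (intr : int -> algC).
have ii : 'i * 'i = -1 :> algC by rewrite -expr2 sqrCi.
have [s [t [p [q [e1 eN1 ei eNi]]]]] : exists s t p q : int,
  [/\ f.[1] = s + t, f.[-1] = s - t,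
     (toC f).['i] = (s + 2 * p)%:~R + (t + 2 * q)%:~R * 'i &
     (toC f).[-'i] = (s + 2 * p)%:~R - (t + 2 * q)%:~R * 'i].
  elim/poly_ind: (f) => [|g c [s [t [p [q [e1 eN1 ei eNi]]]]]].
    exists 0, 0, 0, 0; rewrite /toC rmorph0 !horner0.
    by split; rewrite // ?mulr0 !addr0 mul0r ?subr0 ?addr0.
  exists (t + c), s, (- t - q), p.
  rewrite /toC rmorphD rmorphM /= map_polyX map_polyC /= -/(toC g).
  rewrite !hornerMXaddC e1 eN1 ei eNi; split; [ring|ring| |].
    by rewrite mulrDl -mulrA ii; ring.
  by rewrite mulrN mulrBl -mulrA ii; ring.
exists s, t, p, q; split; first by rewrite (autocorr2 cf) e1.
  by rewrite (autocorrN2 cf) eN1.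
apply: (@intr_inj algC).
have := cf algC (horner_eval 'i \o toC) (horner_eval (-'i) \o toC) (horner_eval
  0 \o toC).
rewrite /= /horner_eval /toC !map_polyX !hornerX subrr mulrN mulNr ii opprK.
move/(_ erefl erefl erefl); rewrite -!/(toC _) ei eNi => e.
rewrite -horner_map rmorph0 -[map_poly _ Hf]/(toC Hf) -e.
rewrite mulrBr !mulrDl; set a := _%:~R; set b := _%:~R.
transitivity (a * a - b * b * ('i * 'i)); first by ring.
by rewrite ii /a /b; ring.
Qed.

(** [H] is linear modulo [t^2 - 1] and modulo [t^2 - 3], and the two remainders
    agree modulo 2 because these moduli do. *)
Lemma modnorm_sqr3 (H : {poly int}) : exists a b r q : int,
  [/\ H.[1] = a + b, H.[-1] = a - b &
      modnorm ('X^2 - 3%:R) H = (a + 2 * r) ^+ 2 - 3 * (b + 2 * q) ^+ 2].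
Proof.
pose toC := map_poly (intr : int -> algC); pose w : algC := sqrtC 3.
have ww : w * w = 3 by rewrite -expr2 sqrtCK.
have [a [b [r [q [e1 eN1 ew eNw]]]]] : exists a b r q : int,
  [/\ H.[1] = a + b, H.[-1] = a - b,
     (toC H).[w] = (a + 2 * r)%:~R + (b + 2 * q)%:~R * w &
     (toC H).[- w] = (a + 2 * r)%:~R - (b + 2 * q)%:~R * w].
  elim/poly_ind: (H) => [|g c [s [t [p [q [e1 eN1 ei eNi]]]]]].
    exists 0, 0, 0, 0; rewrite /toC rmorph0 !horner0.
    by split; rewrite // ?mulr0 !addr0 mul0r ?subr0 ?addr0.
  exists (t + c), s, (t + 3 * q), p.
  rewrite /toC rmorphD rmorphM /= map_polyX map_polyC /= -/(toC g).
  rewrite !hornerMXaddC e1 eN1 ei eNi; split; [ring|ring| |].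
    by rewrite mulrDl -mulrA ww; ring.
  by rewrite mulrN mulrBl -mulrA ww; ring.
exists a, b, r, q; split=> //; apply: (@intr_inj algC).
have m3 : 'X^2 - 3%:R \is @monic int by rewrite -polyC_natr monicXnsubC.
rewrite modnorm_map //.
have -> : map_poly intr ('X^2 - 3%:R) = ('X - w%:P) * ('X - (- w)%:P).
  rewrite rmorphB rmorph_nat /= map_polyXn polyCN opprK mulrDr !mulrBl.
  rewrite -[w%:P * w%:P]polyCM ww -polyC_natr; ring.
rewrite modnormM_closed ?monicXsubC // !modnorm_XsubC -!/(toC _) ew eNw.
rewrite mulrBr !mulrDl; set x := _%:~R; set y := _%:~R.
transitivity (x * x - y * y * (w * w)); first by ring.
by rewrite ww /x /y; ring.
Qed.

Lemma dvdz_expr2r (a b : int) k : (a %| b)%Z -> (a ^+ k %| b ^+ k)%Z.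
Proof. by case/dvdzP=> q ->; rewrite exprMn dvdz_mull. Qed.

Lemma even_or_odd (x : int) : exists y : int, x = 2 * y \/ x = 2 * y + 1.
Proof. by exists (x %/ 2)%Z; lia. Qed.

Lemma consecutive_even (y : int) : exists z : int, y * (y + 1) = 2 * z.
Proof.
by have [u [] ->] := even_or_odd y; [exists (u * (2 * u + 1))
  | exists ((2 * u + 1) * (u + 1))]; ring.
Qed.

(** The three differences are the values of [H] at 2, -2 and 0.  Divisibility by
    256 cannot be seen factor by factor: it comes from the interplay of the
    parities of [t], [t'] and of the halves of [s + t], [s' + t']. *)
Lemma sqr_diff_quad_dvd (s t p q s' t' p' q' a b c : int) :
    a = (s + t) ^+ 2 - (s' + t') ^+ 2 ->
    b = (s - t) ^+ 2 - (s' - t') ^+ 2 ->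
    c = (s + 2 * p) ^+ 2 + (t + 2 * q) ^+ 2
        - ((s' + 2 * p') ^+ 2 + (t' + 2 * q') ^+ 2) ->
  (2 %| c)%Z -> (16 %| a * b)%Z /\ (256 %| a * b * c ^+ 2)%Z.
Proof.
move=> def_a def_b def_c c_even.
have [d ed] : exists d, c = 2 * d by case/dvdzP: c_even => d ->; exists d;
  rewrite mulrC.
have [u hu] := even_or_odd (s + t); have [u' hu'] := even_or_odd (s' + t').
have par : (exists e, c = s + t - (s' + t') + 2 * e).
  have sq x : exists e, x ^+ 2 = x + 2 * e :> int.
    by have [e he] := consecutive_even x; exists (e - x); rewrite mulrBr -he;
      ring.
  have [e1 h1] := sq (s + 2 * p); have [e2 h2] := sq (t + 2 * q).
  have [e3 h3] := sq (s' + 2 * p'); have [e4 h4] := sq (t' + 2 * q').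
  exists (e1 + e2 - e3 - e4 + p + q - p' - q').
  by rewrite def_c h1 h2 h3 h4; ring.
(* so [s + t] and [s' + t'] have the same parity *)
have [e he] := par.
suff [x [y [ex ey]]] : exists x y, a * b = 16 * x /\ a * b * c ^+ 2 = 256 * y.
  by split; [rewrite ex | rewrite ey]; apply: dvdz_mulr.
case: hu hu' => hu [] hu'; [| clear - hu hu' he ed; lia | clear - hu hu' he ed;
  lia |].
- have hs : s = 2 * u - t by rewrite -hu addrK.
  have hs' : s' = 2 * u' - t' by rewrite -hu' addrK.
  have ea : a = 4 * (u ^+ 2 - u' ^+ 2) by rewrite def_a hu hu'; ring.
  have eb : b = 4 * ((u - t) ^+ 2 - (u' - t') ^+ 2) by rewrite def_b hs hs';
    ring.
  have ec : c = 2 * (t ^+ 2 - t' ^+ 2) + 4 * ((u + p) ^+ 2 - (u + p) * t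
     + t * q + q ^+ 2 - ((u' + p') ^+ 2 - (u' + p') * t' + t' * q' + q' ^+ 2)).
    by rewrite def_c hs hs'; ring.
  have eab : a * b = 16 * ((u ^+ 2 - u' ^+ 2) *
    ((u - t) ^+ 2 - (u' - t') ^+ 2)).
    by rewrite ea eb; ring.
  suff [y ey] : exists y, a * b * c ^+ 2 = 256 * y.
    by exists ((u ^+ 2 - u' ^+ 2) * ((u - t) ^+ 2 - (u' - t') ^+ 2)), y.
  (* if [t] and [t'] have the same parity, [4 | c]; otherwise one of the
     quarters of [a] and [b] is divisible by 4 *)
  have [w ht] : exists w, t = t' + 2 * w \/ t = t' + 2 * w + 1.
    by have [w hw] := even_or_odd (t - t'); exists w; clear - hw; lia.
  case: ht => ht.
    have [G {}ec] : exists G, c = 2 * (t ^+ 2 - t' ^+ 2) + 4 * G.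
      by eexists; exact: ec.
    exists ((u ^+ 2 - u' ^+ 2) * ((u - t) ^+ 2 - (u' - t') ^+ 2)
            * (2 * w * t' + 2 * w ^+ 2 + G) ^+ 2).
    have -> : c = 4 * (2 * w * t' + 2 * w ^+ 2 + G) by rewrite ec ht; ring.
    by rewrite eab; ring.
  have [z ez] : exists z, (u ^+ 2 - u' ^+ 2) * ((u - t) ^+ 2 - (u' - t') ^+ 2) =
    4 * z.
    have [v hv] : exists v, u = u' + 2 * v \/ u = u' + 2 * v + 1.
      by have [v hv] := even_or_odd (u - u'); exists v; clear - hv; lia.
    case: hv => hv.
      by exists ((u' * v + v ^+ 2) * ((u - t) ^+ 2 - (u' - t') ^+ 2));
        rewrite hv; ring.
    exists ((u ^+ 2 - u' ^+ 2) * ((u' - t') * (v - w) + (v - w) ^+ 2)).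
    by rewrite hv ht; ring.
  by exists (z * d ^+ 2); rewrite eab ez ed; ring.
- have [x hx] := consecutive_even u; have [x' hx'] := consecutive_even u'.
  have [y hy] := consecutive_even (u - t);
    have [y' hy'] := consecutive_even (u' - t').
  have ea : a = 8 * (x - x').
    transitivity (4 * (u * (u + 1)) - 4 * (u' * (u' + 1))).
      by rewrite def_a hu hu'; ring.
    by rewrite hx hx'; ring.
  have eb : b = 8 * (y - y').
    transitivity (4 * ((u - t) * (u - t + 1)) - 4 *
      ((u' - t') * (u' - t' + 1))).
      rewrite def_b (_ : s = 2 * u + 1 - t); last by rewrite -hu addrK.
      rewrite (_ : s' = 2 * u' + 1 - t'); last by rewrite -hu' addrK.
      by ring.
    by rewrite hy hy'; ring.
  exists (4 * (x - x') * (y - y')), ((x - x') * (y - y') * d ^+ 2).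
  by rewrite ea eb ed; split; ring.
Qed.

(** The factors are the values of [H] at 1 and -1 and its norm modulo
    [t^2 - 3].  If [b] is even each of the two differences is divisible by 4;
    if [b] is odd the first is divisible by 8, the second by 2. *)
Lemma sqr_diff_sqr3_dvd (a b r q : int) : (2 %| a + b)%Z ->
  (4 %| (a + b) * (a - b))%Z /\
  (16 %| (a + b) * (a - b) * ((a + 2 * r) ^+ 2 - 3 * (b + 2 * q) ^+ 2))%Z.
Proof.
case/dvdzP=> y ey; have -> : a = 2 * y - b by lia.
have e1 : (2 * y - b + b) * (2 * y - b - b) = 4 * (y * (y - b)) by ring.
rewrite e1; split; first by rewrite dvdz_mulr.
have [c [] hc] := even_or_odd b; rewrite hc.
  apply/dvdzP; exists ((y * (y - 2 * c)) *
    ((y + r - c) ^+ 2 - 3 * (c + q) ^+ 2)); ring.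
have [z ez] : exists z, y * (y - (2 * c + 1)) = 2 * z.
  have [z hz] := consecutive_even y; exists (z - y - y * c).
  by rewrite !mulrBr -hz; ring.
rewrite ez; apply/dvdzP.
exists (z *
  (2 * (y + r - c) * (y + r - c - 1) - 6 * (c + q) * (c + q + 1) - 1)).
ring.
Qed.

Section Even.
Variables (f g Hf Hg : {poly int}) (n : nat).
Hypotheses (cf : is_autocorr f Hf) (cg : is_autocorr g Hg).
Hypothesis n_gt0 : (0 < n)%N.
Local Notation H := (Hf - Hg).
Local Notation D := (modnorm (chi n) H).

(** [V_m - 2], [V_m] and [V_m + 2] coincide modulo 2. *)
Lemma modnorm_shift_even m c : (0 < m)%N -> c = 2%:R \/ c = - 2%:R ->
  (dickson m + c \is monic) /\
  (2 %| modnorm (dickson m + c) H)%Z = (2 %| modnorm (dickson m) H)%Z.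
Proof.
move=> m_gt0 hc; have [mV sV] := dickson_monic m_gt0.
have mc : dickson m + c \is monic.
  have sc : (size c <= 1)%N.
    by case: hc => ->; rewrite ?size_polyN -polyC_natr size_polyC_leq1.
  by rewrite monicE lead_coefDl ?sV ?(leq_ltn_trans sc).
split=> //; apply: dvdz_modnorm_eqmod => //; rewrite rmorphD /=.
have -> : map_poly (intr : int -> 'F_2) c = 0; last by rewrite addr0.
have p2 : 2%N \in [pchar {poly 'F_2}] by rewrite pchar_poly pchar_Fp.
by case: hc => ->; rewrite ?rmorphN rmorph_nat /= (pcharf0 p2) ?oppr0.
Qed.

Lemma even_chi_double m : (0 < m)%N -> (2 %| modnorm (chi (2 * m)) H)%Z ->
  (2 %| modnorm (dickson m) H)%Z.
Proof.
move=> m_gt0; rewrite chi_double.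
have [m1 e1] := modnorm_shift_even m_gt0 (or_intror erefl).
have [m2 e2] := modnorm_shift_even m_gt0 (or_introl erefl).
by rewrite modnormM // prime_dvdzM // e1 e2 orbb.
Qed.

(** For odd [n], [chi n] is [t - 2] times a square, and [H(2)] is a difference
    of two squares.  For even [n], [chi n] splits into two factors congruent
    modulo 2. *)
Lemma even_dvd4 : (2 %| D)%Z -> (4 %| D)%Z.
Proof.
case: (boolP (odd n)) => [n_odd|n_even].
  have -> : n = (n./2).*2.+1 by rewrite -{1}[n]odd_double_half n_odd.
  have -> k : chi k.*2.+1 = ('X - 2%:P) * dirichlet k ^+ 2.
    by have := dickson_odd k; rewrite /chi polyC_natr.
  rewrite modnormM ?rpredX ?dirichlet_monic ?monicXsubC // modnorm_XsubC
    modnormX ?dirichlet_monic //.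
  rewrite prime_dvdzM // prime_dvdzX // hornerD hornerN (autocorr2 cf)
    (autocorr2 cg).
  case/orP=> [|d]; last first.
    by apply: dvdz_mull; apply: (dvdz_expr2r 2 d).
  rewrite subr_sqr prime_dvdzM // => d; apply: dvdz_mulr.
  have : (2 %| f.[1] - g.[1])%Z /\ (2 %| f.[1] + g.[1])%Z by lia.
  by case; apply: (@dvdz_mul 2 2).
have [m_gt0 def_n] : (0 < n./2)%N /\ n = (2 * n./2)%N.
  by move: n_gt0; rewrite -{1 3}[n]odd_double_half (negPf n_even) mul2n; lia.
rewrite def_n => d; have := even_chi_double m_gt0 d; rewrite chi_double => dV.
have [m1 e1] := modnorm_shift_even m_gt0 (or_intror erefl).
have [m2 e2] := modnorm_shift_even m_gt0 (or_introl erefl).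
by rewrite modnormM // (@dvdz_mul 2 2) ?e1 ?e2.
Qed.

Lemma modnorm_chi_dvd d : (0 < d)%N -> (d %| n)%N -> (modnorm (chi d) H %| D)%Z.
Proof.
move=> d_gt0 /(chi_dvd d_gt0 n_gt0)[U mU ->].
by rewrite modnormM ?dvdz_mulr ?(chi_monic d_gt0).1.
Qed.

Lemma modnorm_chi2 : modnorm (chi 2) H = H.[2] * H.[-2].
Proof. by rewrite chi2 modnormM ?monicXsubC // !modnorm_XsubC. Qed.

Lemma modnorm_chi6 :
  modnorm (chi 6) H = modnorm (chi 2) H * (H.[1] * H.[-1]) ^+ 2.
Proof.
have m2 : chi 2 \is monic by case: (chi_monic (isT : (0 < 2)%N)).
have m1 : ('X - 1%:P) * ('X - (-1)%:P) \is @monic int.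
  by rewrite rpredM ?monicXsubC.
rewrite chi6 modnormM ?rpredX // modnormX // modnormM ?monicXsubC //
  !modnorm_XsubC.
by [].
Qed.

Lemma modnorm_chi12 :
  modnorm (chi 12) H =
    modnorm (chi 6) H * modnorm ('X^2 - 3%:R) H ^+ 2 * H.[0] ^+ 2.
Proof.
have m3 : 'X^2 - 3%:R \is @monic int by rewrite -polyC_natr monicXnsubC.
have m6 : chi 6 \is monic by case: (chi_monic (isT : (0 < 6)%N)).
have m0 : 'X - 0%:P \is @monic int by apply: monicXsubC.
rewrite chi12 modnormM ?rpredM ?rpredX // modnormM ?rpredX // !modnormX //
  modnorm_XsubC.
by [].
Qed.

(** A root of [H] modulo 2 at 0 or at 1 gives enough divisibility within [chi
    2], respectively [chi 6]; otherwise [modnorm_dvd4] applies to both halves of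
    [chi n]. *)
Lemma even_dvd16 : (6 %| n)%N -> (2 %| D)%Z -> (16 %| D)%Z.
Proof.
move=> dvd6 dD; have [s [t [p [q [f2 fN2 f0]]]]] := autocorr_at4 cf.
have [s' [t' [p' [q' [g2 gN2 g0]]]]] := autocorr_at4 cg.
have [a2 aN2 a0] : [/\ H.[2] = (s + t) ^+ 2 - (s' + t') ^+ 2,
    H.[-2] = (s - t) ^+ 2 - (s' - t') ^+ 2 &
    H.[0] = (s + 2 * p) ^+ 2 + (t + 2 * q) ^+ 2
            - ((s' + 2 * p') ^+ 2 + (t' + 2 * q') ^+ 2)].
  by rewrite !hornerD !hornerN f2 fN2 f0 g2 gN2 g0.
case: (boolP (2 %| H.[0])%Z) => [d0|nd0].
  apply: dvdz_trans (modnorm_chi_dvd (isT : (0 < 2)%N) (dvdn_trans _ dvd6)) =>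
    //.
  by rewrite modnorm_chi2; have [] := sqr_diff_quad_dvd a2 aN2 a0 d0.
case: (boolP (2 %| H.[1])%Z) => [d1|nd1].
  apply: dvdz_trans (modnorm_chi_dvd (isT : (0 < 6)%N) dvd6).
  have [a [b [r [q1 [e1 eN1 _]]]]] := modnorm_sqr3 H.
  rewrite modnorm_chi6 e1 eN1; rewrite e1 in d1; apply: dvdz_mull.
  have [d4 _] := sqr_diff_sqr3_dvd r q1 d1.
  exact: (dvdz_expr2r 2 d4).
have [m def_n] : exists m, n = (2 * m)%N.
  by case/dvdnP: dvd6 => m ->; exists (3 * m)%N; lia.
have m_gt0 : (0 < m)%N by move: n_gt0; rewrite def_n muln_gt0 => /andP[].
move: dD; rewrite def_n => /(even_chi_double m_gt0); rewrite chi_double => dV.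
have [m1 e1] := modnorm_shift_even m_gt0 (or_intror erefl).
have [m2 e2] := modnorm_shift_even m_gt0 (or_introl erefl).
by rewrite modnormM // (@dvdz_mul 4 4) // modnorm_dvd4 // ?e1 ?e2.
Qed.

(** As for [even_dvd16], with [chi 12] and the factors [V_m - 2], [V_m + 2] and
    [V_m^2] of [chi (4 m)], each of the first two contributing a factor 4 and
    the square a factor 16. *)
Lemma even_dvd256 : (12 %| n)%N -> (2 %| D)%Z -> (256 %| D)%Z.
Proof.
move=> dvd12 dD; have [s [t [p [q [f2 fN2 f0]]]]] := autocorr_at4 cf.
have [s' [t' [p' [q' [g2 gN2 g0]]]]] := autocorr_at4 cg.
have [a2 aN2 a0] : [/\ H.[2] = (s + t) ^+ 2 - (s' + t') ^+ 2,
    H.[-2] = (s - t) ^+ 2 - (s' - t') ^+ 2 &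
    H.[0] = (s + 2 * p) ^+ 2 + (t + 2 * q) ^+ 2
            - ((s' + 2 * p') ^+ 2 + (t' + 2 * q') ^+ 2)].
  by rewrite !hornerD !hornerN f2 fN2 f0 g2 gN2 g0.
have dvdchi := modnorm_chi_dvd (isT : (0 < 12)%N) dvd12.
case: (boolP (2 %| H.[0])%Z) => [d0|nd0].
  apply: dvdz_trans dvdchi; rewrite modnorm_chi12 modnorm_chi6 modnorm_chi2.
  have [_ d256] := sqr_diff_quad_dvd a2 aN2 a0 d0.
  have e (A B N X : int) : A * B * N * X = A * X * (B * N) by ring.
  by rewrite e; apply: dvdz_mulr.
case: (boolP (2 %| H.[1])%Z) => [d1|nd1].
  apply: dvdz_trans dvdchi; rewrite modnorm_chi12 modnorm_chi6 dvdz_mulr //.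
  rewrite -mulrA -exprMn; apply: dvdz_mull.
  have [a [b [r [q1 [e1 eN1 eS]]]]] := modnorm_sqr3 H.
  rewrite e1 eN1 eS; rewrite e1 in d1.
  have [_ d16] := sqr_diff_sqr3_dvd r q1 d1.
  exact: (dvdz_expr2r 2 d16).
have [m def_n] : exists m, n = (4 * m)%N.
  by case/dvdnP: dvd12 => m ->; exists (3 * m)%N; lia.
have m_gt0 : (0 < m)%N by move: n_gt0; rewrite def_n muln_gt0 => /andP[].
move: dD; rewrite def_n chi_quad.
have [m1 e1] := modnorm_shift_even m_gt0 (or_intror erefl).
have [m2 e2] := modnorm_shift_even m_gt0 (or_introl erefl).
have [mV _] := dickson_monic m_gt0.
rewrite modnormM ?rpredM ?rpredX // modnormX // [modnorm (_ * _) _]modnormM //.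
rewrite !(prime_dvdzM _ _ (isT : prime 2)) e1 e2 !orbb => dV.
rewrite (@dvdz_mul 16 16) //;
  first by rewrite (@dvdz_mul 4 4) // modnorm_dvd4 // ?e1 ?e2.
exact: (dvdz_expr2r 2 (modnorm_dvd4 nd0 nd1 dV)).
Qed.
End Even.

(** * Determinants attained by geometric sums *)

Lemma det_cyc n' (z : algC) (F : {poly int}) : n'.+1.-primitive_root z ->
  (\det (horner_mx (cyc n') F))%:~R
    = \prod_(0 <= i < n'.+1) (map_poly intr F).[z ^+ i] :> algC.
Proof.
move=> prim_z; set n := n'.+1 in prim_z *.
have [r Hr] := closed_field_poly_normal (map_poly intr F : {poly algC}).
rewrite -mxevalE det_mxeval_map (det_mxeval_root _ Hr).
rewrite [in RHS]Hr; set a := lead_coef _.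
under [RHS]eq_bigr => i _ do rewrite hornerZ horner_prod.
rewrite [RHS]big_split /= prodr_const_nat subn0; congr (_ * _).
rewrite exchange_big /=; apply: eq_bigr => b _.
rewrite -map_char_poly char_poly_cyc rmorphB rmorph1 /= map_polyXn.
rewrite -(factor_Xn_sub_1 prim_z) horner_prod -{1}[n]subn0 -prodr_const_nat.
rewrite -big_split /=; apply: eq_bigr => i _.
by rewrite !hornerXsubC mulN1r opprB.
Qed.

(** The value at 1 of [(X^m - 1) / (X - 1) = 1 + X + ... + X^(m-1)]. *)
Lemma prod_1_sub_prim (m : nat) (w : algC) : m.-primitive_root w ->
  \prod_(1 <= i < m) (1 - w ^+ i) = m%:R.
Proof.
move=> prim_w; have m_gt0 := prim_order_gt0 prim_w.
have := factor_Xn_sub_1 prim_w.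
rewrite big_ltn // expr0 subrX1 polyC1.
have nz : 'X - 1 != 0 :> {poly algC} by rewrite -polyC1 polyXsubC_eq0.
move/(mulfI nz)/(congr1 (fun p => p.[1])); rewrite horner_prod horner_sum.
under eq_bigr => i _ do rewrite hornerXsubC.
move=> ->; under eq_bigr => i _ do rewrite hornerXn expr1n.
by rewrite sumr_const card_ord.
Qed.

(** For [i > 0] the factor is [(1 - w^(q i)) / (1 - w^i)], and both numerators
    and denominators multiply to [m] because [w^q] is again a primitive root. *)
Lemma prod_geom_prim (m q : nat) (w : algC) :
    m.-primitive_root w -> coprime q m ->
  \prod_(0 <= i < m) \sum_(j < q) w ^+ (i * j) = q%:R.
Proof.
move=> prim_w co_qm; have m_gt0 := prim_order_gt0 prim_w.
have prim_wq : m.-primitive_root (w ^+ q) by rewrite prim_root_exp_coprime.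
rewrite big_ltn // (_ : \sum_(j < q) w ^+ (0 * j) = q%:R); last first.
  by under eq_bigr => j _ do rewrite mul0n expr0; rewrite sumr_const card_ord.
rewrite -[RHS]mulr1; congr (_ * _).
have m_nz : m%:R != 0 :> algC by rewrite pnatr_eq0 -lt0n.
apply: (mulfI m_nz); rewrite mulr1 -{1}(prod_1_sub_prim prim_w) -big_split /=.
rewrite -(prod_1_sub_prim prim_wq); apply: eq_bigr => i _.
under eq_bigr => j _ do rewrite exprM.
by rewrite -opprB mulNr -subrX1 opprB -!exprM mulnC.
Qed.

Lemma prod_periodic (g : nat -> algC) m e : (forall i, g (m + i)%N = g i) ->
  \prod_(0 <= i < e * m) g i = (\prod_(0 <= i < m) g i) ^+ e.
Proof.
move=> gP; elim: e => [|e IHe]; first by rewrite mul0n big_geq.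
rewrite mulSn (big_cat_nat (n := m)) ?leq_addr //= exprS -IHe; congr (_ * _).
rewrite -{1}[m]add0n big_addn addKn; apply: eq_bigr => i _.
by rewrite addnC gP.
Qed.

Definition geom (q e : nat) : {poly int} := \sum_(j < q) 'X^e ^+ j.

Lemma det_geom n' q e m : n'.+1 = (e * m)%N -> coprime q m ->
  \det (horner_mx (cyc n') (geom q e)) = Posz (q ^ e).
Proof.
move=> def_n co_qm; apply: (@intr_inj algC).
have [z prim_z] := C_prim_root_exists (isT : (0 < n'.+1)%N).
rewrite (det_cyc _ prim_z).
have [e_gt0 m_gt0] : (0 < e)%N /\ (0 < m)%N by split; lia.
have prim_w : m.-primitive_root (z ^+ e).
  have := exp_prim_root prim_z e; rewrite def_n.
  by rewrite (gcdn_idPl (dvdn_mulr _ (dvdnn e))) mulKn.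
pose g i := \sum_(j < q) (z ^+ e) ^+ (i * j).
rewrite (eq_bigr g) => [|i _].
  rewrite def_n prod_periodic => [|i].
    by rewrite (prod_geom_prim prim_w co_qm) -natrX pmulrn.
  apply: eq_bigr => j _; rewrite mulnDl exprD exprM (prim_expr_order prim_w).
  by rewrite expr1n mul1r.
rewrite /geom /g rmorph_sum horner_sum; apply: eq_bigr => j _.
rewrite -exprM rmorphXn /= map_polyX hornerXn -!exprM; congr (_ ^+ _).
by rewrite mulnCA mulnA mulnC mulnA mulnC.
Qed.

(** With [v = u^-1] this reads
    [|1 + ... + u^k|^2 - |1 + ... + u^(k-1)|^2 = u^-k + ... + u^k]. *)
Lemma geom_diff (A : nzRingType) (u v : A) k : u * v = 1 -> v * u = 1 ->
  u ^+ k * ((\sum_(j < k.+1) v ^+ j) * (\sum_(j < k.+1) u ^+ j)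
            - (\sum_(j < k) v ^+ j) * (\sum_(j < k) u ^+ j))
  = \sum_(j < k.*2.+1) u ^+ j.
Proof.
move=> uv vu; rewrite !(big_ord_recr k) /=.
have uvk i : u ^+ i * v ^+ i = 1.
  by elim: i => [|i IHi]; rewrite ?mulr1 // exprSr exprS mulrA -(mulrA _ u) uv
    mulr1.
set a := \sum_(j < k) u ^+ j; set b := \sum_(j < k) v ^+ j.
have -> : (b + v ^+ k) * (a + u ^+ k) - b * a = b * u ^+ k + v ^+ k * (a + u ^+
  k).
  by rewrite mulrDl mulrDr addrAC [b * a + _]addrC addrK.
rewrite mulrDr [X in _ + X]mulrA uvk mul1r mulrA.
have -> : k.*2.+1 = (k + k.+1)%N by rewrite addnS addnn.
rewrite big_split_ord /= [LHS]addrC -[LHS]addrA; congr (_ + _).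
rewrite big_ord_recl addn0; congr (_ + _).
rewrite /b mulr_sumr mulr_suml (reindex_inj rev_ord_inj) /=.
apply: eq_bigr => j _; have lt_jk := ltn_ord j.
have -> : u ^+ k * v ^+ (k - j.+1) = u ^+ j.+1.
  by rewrite -{1}(subnKC lt_jk) exprD -mulrA uvk mulr1.
by rewrite -exprD addnC.
Qed.

Lemma det_cyc_unit n' : absz (\det (cyc n')) = 1%N.
Proof.
have := congr1 determinant (cyc_mul_tr n'); rewrite det_mulmx det_tr det1.
by move/(congr1 absz); rewrite abszM => /eqP; rewrite muln_eq1 => /andP[/eqP].
Qed.

Lemma dihedral_det_geom n' k e m : n'.+1 = (e * m)%N -> coprime k.*2.+1 m ->
  absz (dihedral_det n' (geom k.+1 e) (geom k e)) = (k.*2.+1 ^ e)%N.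
Proof.
move=> def_n co; pose u := cyc n' ^+ e; pose v := (cyc n')^T ^+ e.
have cu q (M : 'M_n'.+1) : horner_mx M (geom q e) = \sum_(j < q) (M ^+ e) ^+ j.
  rewrite /geom rmorph_sum; apply: eq_bigr => j _ /=.
  by rewrite !rmorphXn /= horner_mx_X.
have cv : GRing.comm (cyc n') (cyc n')^T.
  by rewrite /GRing.comm -!mulmxE cyc_mul_tr cyc_tr_mul.
have uv : u * v = 1 by rewrite -exprMn_comm // -mulmxE cyc_mul_tr expr1n.
have vu : v * u = 1.
  by rewrite -exprMn_comm; [rewrite -mulmxE cyc_tr_mul expr1n | apply:
    commr_sym].
have := det_geom def_n co; rewrite cu -(geom_diff k uv vu) -mulmxE.
rewrite det_mulmx => /(congr1 absz); rewrite abszM.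
have -> : absz (\det (u ^+ k)) = 1%N.
  rewrite /u -exprM; elim: (e * k)%N => [|i IHi]; first by rewrite det1.
  by rewrite exprS det_mulmx abszM IHi det_cyc_unit.
by rewrite mul1n => e1; rewrite /dihedral_det !cu; exact: e1.
Qed.

Lemma dihedral_det_two n' e m : n'.+1 = (e * m)%N -> odd m ->
  absz (dihedral_det n' (geom 2 e) 0) = ((2 ^ e) ^ 2)%N.
Proof.
move=> def_n m_odd; rewrite /dihedral_det !rmorph0 mulmx0 subr0 det_mulmx.
rewrite horner_mx_tr det_tr abszM (det_geom def_n) ?coprime2n //.
Qed.

(** * The values of [lambda] *)

Definition dihedral_value n k :=
  exists f g : {poly int}, absz (dihedral_det n.-1 f g) = k.

Lemma lambda_dihedral n (gT : finGroupType) (G : {group gT}) v :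
    (0 < n)%N -> dihedral n G -> (2 <= v)%N -> dihedral_value n v ->
    (forall k, (2 <= k < v)%N -> ~ dihedral_value n k) ->
  lambda G = v.
Proof.
case: n => // n _ dihG v_ge2 val_v min_v.
rewrite /lambda; case: ex_minnP => k /andP[k_ge2 /boolp.asboolP val_k] min_k.
apply/eqP; rewrite eqn_leq; apply/andP; split.
  apply: min_k; rewrite /abs_group_det v_ge2; apply/boolp.asboolP.
  by apply/(dihedral_values dihG).
rewrite leqNgt; apply/negP => lt_kv; apply: (min_v k); first by rewrite k_ge2.
by apply/(dihedral_values dihG).
Qed.

Lemma dihedral_value_dvd n k : (0 < n)%N -> dihedral_value n k ->
  [/\ (2 %| k)%N -> (4 %| k)%N,
      (6 %| n)%N -> (2 %| k)%N -> (16 %| k)%N,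
      (12 %| n)%N -> (2 %| k)%N -> (256 %| k)%N,
      forall p, prime p -> odd p -> (p %| n)%N -> (p %| k)%N -> (p ^ 3 %| k)%N &
      forall p, prime p -> odd p -> (p ^ 2 %| n)%N -> (p %| k)%N ->
        (p ^ 5 %| k)%N].
Proof.
move=> n_gt0 [f [g <-]]; have [Hf cf] := autocorr f; have [Hg cg] := autocorr g.
rewrite (dihedral_det_modnorm n.-1 cf cg) prednK //; split.
- exact: (even_dvd4 cf cg n_gt0).
- exact: (even_dvd16 cf cg n_gt0).
- exact: (even_dvd256 cf cg n_gt0).
- by move=> p p_pr p_odd pn; apply: (dvdz_odd_prime p_pr p_odd n_gt0 pn).
- by move=> p p_pr p_odd pn; apply: (dvdz_odd_prime2 p_pr p_odd n_gt0 pn).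
Qed.

(** A value [k < v] is a multiple of its least prime factor [q < v], and the
    hypotheses make [k] divisible by a number that is at least [v]. *)
Lemma dihedral_value_lower n v : (0 < n)%N ->
    (2 < v)%N ==>
      [|| v <= 4, (6 %| n) && (v <= 16) | (12 %| n) && (v <= 256)]%N ->
    (3 < v)%N ==> [|| (3 %| n) && (v <= 27) | (9 %| n) && (v <= 243)]%N ->
    (v <= 125)%N -> (forall q, prime q -> (5 <= q < v)%N -> (q %| n)%N) ->
  forall k, (2 <= k < v)%N -> ~ dihedral_value n k.
Proof.
move=> n_gt0 h2 h3 v125 h5 k /andP[k_ge2 lt_kv] val_k.
have [d4 d16 d256 d3 d5] := dihedral_value_dvd n_gt0 val_k.
have k_gt0 : (0 < k)%N by apply: ltnW.
have le_k d : (d %| k)%N -> (d <= k)%N by apply: dvdn_leq.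
have q_pr := pdiv_prime k_ge2; have dvd_q := pdiv_dvd k.
have lt_qv := leq_ltn_trans (le_k _ dvd_q) lt_kv.
move: (pdiv k) q_pr dvd_q lt_qv => q q_pr dvd_q lt_qv.
have [q2|q_odd] := even_prime q_pr.
  rewrite q2 in dvd_q lt_qv.
  case/or3P: (implyP h2 lt_qv) => [|/andP[n6]|/andP[n12]]; rewrite leqNgt;
    apply/negP; rewrite negbK; apply: leq_ltn_trans lt_kv; apply: le_k.
  - exact: d4.
  - exact: d16.
  - exact: d256.
have [q3|q_ne3] := eqVneq q 3%N.
  rewrite q3 in dvd_q lt_qv.
  case/orP: (implyP h3 lt_qv) => /andP[n3]; rewrite leqNgt; apply/negP;
    rewrite negbK; apply: leq_ltn_trans lt_kv; apply: le_k.
  - exact: (d3 3%N).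
  - exact: (d5 3%N).
have q_ge5 : (5 <= q)%N.
  by case: q q_pr q_odd q_ne3 {dvd_q lt_qv} => [|[|[|[|[|q]]]]].
have dvd_qn : (q %| n)%N by apply: h5; rewrite ?q_ge5.
have : (5 ^ 3 <= k)%N.
  by apply: leq_trans (le_k _ (d3 q q_pr q_odd dvd_qn dvd_q));
    rewrite leq_exp2r.
by rewrite leqNgt (leq_trans lt_kv v125).
Qed.

Lemma dihedral_value_geom n q e m :
  (0 < n)%N -> n = (e * m)%N -> odd q -> coprime q m ->
  dihedral_value n (q ^ e).
Proof.
case: n => // n _ def_n q_odd co_qm; exists (geom q./2.+1 e), (geom q./2 e).
have def_q : q = q./2.*2.+1 by rewrite -[LHS]odd_double_half q_odd.
by rewrite def_q in co_qm; rewrite (dihedral_det_geom def_n co_qm) -def_q.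
Qed.

Lemma dihedral_value_two n e m :
  (0 < n)%N -> n = (e * m)%N -> odd m -> dihedral_value n ((2 ^ e) ^ 2).
Proof.
by case: n => // n _ def_n m_odd; exists (geom 2 e), 0;
  rewrite (dihedral_det_two def_n).
Qed.

Lemma lambda_prime n (gT : finGroupType) (G : {group gT}) p :
    (0 < n)%N -> dihedral n G -> prime p -> odd p -> ~~ (p %| n)%N ->
    (2 < p)%N ==>
      [|| p <= 4, (6 %| n) && (p <= 16) | (12 %| n) && (p <= 256)]%N ->
    (3 < p)%N ==> [|| (3 %| n) && (p <= 27) | (9 %| n) && (p <= 243)]%N ->
    (p <= 125)%N -> (forall q, prime q -> (5 <= q < p)%N -> (q %| n)%N) ->
  lambda G = p.
Proof.
move=> n_gt0 dihG p_pr p_odd npn h2 h3 h h5.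
apply: (lambda_dihedral n_gt0 dihG (prime_gt1 p_pr)).
  rewrite -[p]expn1; apply: (@dihedral_value_geom n p 1 n) => //.
    by rewrite mul1n.
  by rewrite prime_coprime.
exact: dihedral_value_lower.
Qed.

Lemma small_primes v q : prime q -> (5 <= q < v)%N ->
  q \in [seq r <- iota 5 (v - 5) | prime r].
Proof.
move=> q_pr /andP[q5 qv]; rewrite mem_filter q_pr mem_iota q5 subnKC //.
by apply: leq_trans qv; apply: ltnW.
Qed.

Local Open Scope nat_scope.

(** The match on products is syntactic because unification would read [2 ^ 2] as
    a product and end up computing with large unary numbers. *)
Ltac dvd_head def_n :=
  rewrite def_n;
  repeat match goal with |- is_true (_ %| _ * _ * _) => apply: dvdn_mulr end.
Ltac prime_factors def_n := rewrite def_n ?[all _ _]/= ?Euclid_dvdM.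

Theorem theorem4p1 (n : nat) (n_ge1 : 1 <= n)
    (gT : finGroupType) (G : {group gT}) (dihG : dihedral n G) :
  (~~ (3 %| n) -> lambda G = 3) /\
  (forall m : nat, 0 < m ->
     n = 3 * m -> ~~ (2 %| m) -> lambda G = 4) /\
  (forall m : nat, 0 < m ->
     n = 2 * 3 * m -> ~~ (5 %| m) -> lambda G = 5) /\
  (forall m : nat, 0 < m ->
     n = 2 * 3 * 5 * m -> ~~ (7 %| m) -> lambda G = 7) /\
  (forall m : nat, 0 < m ->
     n = 2 * 3 * 5 * 7 * m -> ~~ (11 %| m) -> lambda G = 11) /\
  (forall m : nat, 0 < m ->
     n = 2 * 3 * 5 * 7 * 11 * m -> ~~ (13 %| m) -> lambda G = 13) /\
  (forall m : nat, 0 < m ->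
     n = 2 * 3 * 5 * 7 * 11 * 13 * m -> ~~ (2 %| m) -> lambda G = 16) /\
  (forall m : nat, 0 < m ->
     n = 2 ^ 2 * 3 * 5 * 7 * 11 * 13 * m -> ~~ (17 %| m) -> lambda G = 17) /\
  (forall m : nat, 0 < m ->
     n = 2 ^ 2 * 3 * 5 * 7 * 11 * 13 * 17 * m -> ~~ (19 %| m) ->
     lambda G = 19) /\
  (forall m : nat, 0 < m ->
     n = 2 ^ 2 * 3 * 5 * 7 * 11 * 13 * 17 * 19 * m -> ~~ (23 %| m) ->
     lambda G = 23) /\
  (forall m : nat, 0 < m ->
     n = 2 ^ 2 * 3 * 5 * 7 * 11 * 13 * 17 * 19 * 23 * m -> ~~ (3 %| m) ->
     lambda G = 27) /\
  (forall m : nat, 0 < m ->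
     n = 2 ^ 2 * 3 ^ 2 * 5 * 7 * 11 * 13 * 17 * 19 * 23 * m -> ~~ (29 %| m) ->
     lambda G = 29) /\
  (forall p : nat, prime p -> 31 <= p <= 113 ->
   forall m : nat, 0 < m ->
     n = 2 ^ 2 * 3 ^ 2 * (\prod_(5 <= q < p | prime q) q) * m ->
     ~~ (p %| m) -> lambda G = p).
Proof.
split=> [n3|].
  by apply: (lambda_prime n_ge1 dihG) => // q _; case: q => [|[|[|[|[|q]]]]].
split=> [m _ def_n m_odd|].
  have n_odd : odd n by rewrite def_n oddM /=; move: m_odd; rewrite dvdn2 negbK.
  apply: (lambda_dihedral n_ge1 dihG) => //.
    (* 4 is the squared determinant of [1 + C] *)
    by apply: (@dihedral_value_two n 1 n); rewrite ?mul1n.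
  apply: dihedral_value_lower => //; first by rewrite def_n dvdn_mulr.
  by move=> q _ /andP[q5 q4]; have := leq_trans q5 (ltnW q4).
have prime_case p : prime p -> odd p -> 5 <= p -> p <= 125 ->
    ~~ (p %| n) -> (6 %| n) && (p <= 16) || (12 %| n) && (p <= 256) ->
    (3 %| n) && (p <= 27) || (9 %| n) && (p <= 243) ->
    all (fun q => q %| n) [seq r <- iota 5 (p - 5) | prime r] -> lambda G = p.
  move=> p_pr p_odd p5 p125 npn h2 h3 /allP h5.
  apply: (lambda_prime n_ge1 dihG) => //; try by rewrite ?h2 ?h3 ?orbT implybT.
  by move=> q q_pr q_int; apply: h5; apply: small_primes.
have prime_case6 p : prime p -> odd p -> 5 <= p -> p <= 16 ->
    ~~ (p %| n) -> 6 %| n ->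
    all (fun q => q %| n) [seq r <- iota 5 (p - 5) | prime r] -> lambda G = p.
  move=> p_pr p_odd p5 p16 npn n6.
  have n3 : 3 %| n by apply: dvdn_trans n6.
  by apply: prime_case; rewrite ?n6 ?n3 ?p16 ?(leq_trans p16).
have prime_case12 p : prime p -> odd p -> 5 <= p -> p <= 27 ->
    ~~ (p %| n) -> 12 %| n ->
    all (fun q => q %| n) [seq r <- iota 5 (p - 5) | prime r] -> lambda G = p.
  move=> p_pr p_odd p5 p27 npn n12.
  have n3 : 3 %| n by apply: dvdn_trans n12.
  have le_p v : 27 <= v -> p <= v by apply: leq_trans.
  by apply: prime_case; rewrite ?n12 ?n3 ?p27 ?(le_p 125) ?(le_p 256) ?orbT.
split=> [m _ def_n nd|].
  have n6 : 6 %| n by dvd_head def_n.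
  by apply: prime_case6 => //; prime_factors def_n; rewrite ?Euclid_dvdX.
split=> [m _ def_n nd|].
  have n6 : 6 %| n by dvd_head def_n.
  by apply: prime_case6 => //; prime_factors def_n; rewrite ?Euclid_dvdX.
split=> [m _ def_n nd|].
  have n6 : 6 %| n by dvd_head def_n.
  by apply: prime_case6 => //; prime_factors def_n; rewrite ?Euclid_dvdX.
split=> [m _ def_n nd|].
  have n6 : 6 %| n by dvd_head def_n.
  by apply: prime_case6 => //; prime_factors def_n; rewrite ?Euclid_dvdX.
split=> [m _ def_n m_odd|].
  have def_n2 : n = 2 * (3 * (5 * (7 * (11 * (13 * m))))) by rewrite def_n
    -!mulnA.
  have n6 : 6 %| n by dvd_head def_n.
  apply: (lambda_dihedral n_ge1 dihG) => //.
    (* 16 is the squared determinant of [1 + C^2] *)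
    apply: (@dihedral_value_two n 2 _ n_ge1 def_n2).
    by rewrite !oddM /=; move: m_odd; rewrite dvdn2 negbK.
  apply: dihedral_value_lower => //; first by rewrite n6.
    by rewrite (dvdn_trans _ n6).
  have h5 : all (fun q => q %| n) [seq r <- iota 5 (16 - 5) | prime r].
    by rewrite def_n ?[all _ _]/= !Euclid_dvdM.
  by move=> q q_pr q_int; apply: (allP h5); apply: small_primes.
split=> [m _ def_n nd|].
  have n12 : 12 %| n by dvd_head def_n.
  by apply: prime_case12 => //; prime_factors def_n; rewrite ?Euclid_dvdX.
split=> [m _ def_n nd|].
  have n12 : 12 %| n by dvd_head def_n.
  by apply: prime_case12 => //; prime_factors def_n; rewrite ?Euclid_dvdX.
split=> [m _ def_n nd|].
  have n12 : 12 %| n by dvd_head def_n.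
  by apply: prime_case12 => //; prime_factors def_n; rewrite ?Euclid_dvdX.
split=> [m _ def_n m3|].
  have n12 : 12 %| n by dvd_head def_n.
  apply: (lambda_dihedral n_ge1 dihG) => //.
    (* 27 is the determinant of [1 + C^3 + C^6] *)
    apply: (@dihedral_value_geom n 3 3
      (2 ^ 2 * (5 * (7 * (11 * (13 * (17 * (19 * (23 * m)))))))) n_ge1) => //.
      (* over variables, so that [2 ^ 2] is not taken for a product *)
      have shuffle x a b c d e f g k :
          x * 3 * a * b * c * d * e * f * g * k
          = 3 * (x * (a * (b * (c * (d * (e * (f * (g * k)))))))).
        by rewrite -!mulnA mulnCA.
      by rewrite def_n shuffle.
    by rewrite prime_coprime // !Euclid_dvdM // (negPf m3).
  apply: dihedral_value_lower => //; first by rewrite n12 orbT.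
    by rewrite (dvdn_trans _ n12).
  have h5 : all (fun q => q %| n) [seq r <- iota 5 (27 - 5) | prime r].
    by rewrite def_n ?[all _ _]/= !Euclid_dvdM.
  by move=> q q_pr q_int; apply: (allP h5); apply: small_primes.
split=> [m _ def_n nd|].
  have n36 : 36 %| n by dvd_head def_n.
  have n12 : 12 %| n by apply: dvdn_trans n36.
  have n9 : 9 %| n by apply: dvdn_trans n36.
  by apply: prime_case; rewrite ?n12 ?n9 ?orbT //; prime_factors def_n;
    rewrite ?Euclid_dvdX.
move=> p p_pr /andP[p31 p113] m _ def_n npm.
set P := \prod_(5 <= q < p | prime q) q in def_n.
have dvdP q : prime q -> 5 <= q < p -> q %| P.
  move=> q_pr q_int; rewrite /P big_mkcond.
  by rewrite (bigD1_seq q) ?mem_index_iota ?iota_uniq //= q_pr dvdn_mulr.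
have npP : ~~ (p %| P).
  rewrite /P big_seq_cond; apply: (big_ind (fun x => ~~ (p %| x))).
  - by rewrite gtnNdvd // prime_gt1.
  - by move=> x y npx npy; rewrite Euclid_dvdM // negb_or npx.
  - move=> q /andP[]; rewrite mem_index_iota => /andP[q5 qp] q_pr.
    by rewrite gtnNdvd // prime_gt0.
have p_odd : odd p by case: (even_prime p_pr) => // p2; rewrite p2 in p31.
have n36 : 36 %| n by dvd_head def_n.
apply: (lambda_prime n_ge1 dihG) => //.
- have np d : 0 < d < 31 -> (p %| d) = false.
    case/andP=> d_gt0 d31; apply/negbTE; rewrite gtnNdvd //.
    exact: leq_trans d31 p31.
  by rewrite def_n !Euclid_dvdM // (negPf npP) (negPf npm) !np.
- apply/implyP=> _; apply/or3P; apply: Or33.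
  by rewrite (dvdn_trans _ n36) //; apply: leq_trans p113 _.
- apply/implyP=> _; apply/orP; right.
  by rewrite (dvdn_trans _ n36) //; apply: leq_trans p113 _.
- by apply: leq_trans p113 _.
- by move=> q q_pr q_int; rewrite def_n dvdn_mulr // dvdn_mull // dvdP.
Qed.
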